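(* For each $n$, let $Q_n(u)=\inf\{x\in\mathbb{R}:\Pr[X_n\leq x]\geq u\}$ be the quantile function of a real-valued statistic $X_n$, assumed to be strictly increasing. Let $\mathcal{U}_n=[\varepsilon_n,1-\varepsilon_n]$, where $(\varepsilon_n)$ is a sequence with $0<\varepsilon_n<1/2$ (possibly going to zero), and let $(a_n)$ be a sequence of positive numbers going to zero as $n\to\infty$. Let $\widehat Q_n:\mathcal{U}_n\to\mathbb{R}$ be measurable functions such that $$Q_n(u)=\widehat Q_n(u)+\epsilon_n(u),\qquad |\epsilon_n(u)|\leq a_n\quad\text{for all }u\in\mathcal{U}_n.$$ Let $\widehat Q_n^*$ be the increasing rearrangement of $\widehat Q_n$ on $\mathcal{U}_n$. Then for every $n$ and every $p\in[1,\infty]$, $$\left[\int_{\mathcal{U}_n}\left|\widehat Q_n^*(u)-Q_n(u)\right|^p du\right]^{1/p}\leq\left[\int_{\mathcal{U}_n}\left|\widehat Q_n(u)-Q_n(u)\right|^p du\right]^{1/p}\leq(1-2\varepsilon_n)^{1/p}\,a_n,$$ and the first inequality is strict for $p\in(1,\infty)$ whenever $\widehat Q_n$ is (strictly) decreasing over a subset of $\mathcal{U}_n$ of positive Lebesgue measure. In particular, this applies to the $J$-th order inverse Edgeworth (Cornish-Fisher) approximation to the quantile function of the sample mean: if $X_n=n^{-1/2}\sum_{i=1}^n(Y_i-E[Y_i])/\sqrt{\mathrm{Var}(Y_i)}$ is the standardized sample mean of a random sample $(Y_1,\dots,Y_n)$ of $Y$, with $Q_n$ strictly increasing, if $$\widehat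 Q_n(u)=R_1(\Phi^{-1}(u))+R_2(\Phi^{-1}(u))/n^{1/2}+\dots+R_J(\Phi^{-1}(u))/n^{(J-1)/2},$$ where $R_1,\dots,R_J$ are the Cornish-Fisher polynomials, and if for some $C>0$ and some $\varepsilon_n\searrow0$ one has $|Q_n(u)-\widehat Q_n(u)|\leq Cn^{-J/2}$ for all $u\in\mathcal{U}_n=[\varepsilon_n,1-\varepsilon_n]$, then for every $n$ and every $p\in[1,\infty]$, $$\left[\int_{\mathcal{U}_n}\left|\widehat Q_n^*(u)-Q_n(u)\right|^p du\right]^{1/p}\leq\left[\int_{\mathcal{U}_n}\left|\widehat Q_n(u)-Q_n(u)\right|^p du\right]^{1/p}\leq(1-2\varepsilon_n)^{1/p}\,Cn^{-J/2},$$ and the first inequality is strict for $p\in(1,\infty)$ whenever $\widehat Q_n$ is (strictly) decreasing over a subset of $\mathcal{U}_n$ of positive Lebesgue measure.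
   Context: Increasing rearrangement. For a bounded measurable function $f:[0,1]\to\mathbb{R}$, let $F_f(y)=\int_0^1 1\{f(u)\leq y\}\,du$. The increasing rearrangement of $f$ is the quantile function $f^*(x)=\inf\{y\in\mathbb{R}: F_f(y)\geq x\}$, $x\in[0,1]$ (the value at the single endpoint $x=0$ is immaterial). For a bounded measurable $f:[a,b]\to\mathbb{R}$ with $a<b$, put $\bar f(\bar x)=f(a+(b-a)\bar x)$ for $\bar x\in[0,1]$, and define $f^*(x)=\bar f^*\big((x-a)/(b-a)\big)$ for $x\in[a,b]$. For $p=\infty$ the $L_p$ norms are essential suprema and $(1-2\varepsilon_n)^{1/p}=1$. A function is decreasing over a set $A$ if its restriction to $A$ is strictly decreasing. $\Phi$ and $\Phi^{-1}$ are the standard normal distribution and quantile functions. The Cornish-Fisher polynomials $R_j$ have coefficients determined by moments of $Y$; the first three are $R_1(z)=z$, $R_2(z)=\lambda(z^2-1)/6$, $R_3(z)=(3\kappa(z^3-3z)-2\lambda^2(2z^3-5z))/72$, where $\lambda$ is the skewness and $\kappa$ the (excess) kurtosis of $Y$. *)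

(* Defs.v *)
From HB Require Import structures.
From mathcomp Require Import all_boot all_order all_algebra.
From mathcomp Require Import all_classical all_reals all_analysis.
From mathcomp Require Import ring.

Set Implicit Arguments.
Unset Strict Implicit.
Unset Printing Implicit Defensive.

Import Order.TTheory GRing.Theory Num.Theory.
Import numFieldNormedType.Exports.

Local Open Scope classical_set_scope.
Local Open Scope ring_scope.

Section Rearrangement.
Context {R : realType}.
Implicit Types (f g : R -> R) (A : set R).
Local Notation mu := (@lebesgue_measure R).

Definition distr01 f (y : R) : \bar R :=
  (\int[mu]_(u in `[0%R, 1%R]) (\1_[set v | f v <= y] u)%:E)%E.

(* the infimum is -oo at x = 0, where `inf` returns a junk value *)
Definition rearrangement01 f (x : R) : R :=
  inf [set y | (x%:E <= distr01 f y)%E].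

Definition rearrangement (a b : R) f (x : R) : R :=
  rearrangement01 (fun t => f (a + (b - a) * t)) ((x - a) / (b - a)).

(* L_p(A) norm of f - g: for 1 <= p, extending f - g by 0 outside A changes
   neither the integral (p < +oo) nor the essential supremum (p = +oo) *)
Definition Lp_dist A (p : \bar R) f g : \bar R :=
  'N[mu]_p[EFin \o ((f \- g)%R \_ A)]%E.

Definition strictly_increasing_on A f :=
  forall u v, A u -> A v -> u < v -> f u < f v.

Definition strictly_decreasing_on A f :=
  forall u v, A u -> A v -> u < v -> f v < f u.

End Rearrangement.

Section Statistics.
Context {R : realType}.

(* `inf` is a genuine infimum when 0 < u < 1: the set is then nonempty and
   bounded below *)
Definition quantile d (T : measurableType d) (P : probability T R)
    (X : T -> R) (u : R) : R :=
  inf [set x | (u%:E <= P [set w | (X w <= x)%R])%E].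

Definition normal_cdf (x : R) : R := fine (normal_prob 0 1 `]-oo, x]).

Definition normal_quantile (u : R) : R := inf [set x | u <= normal_cdf x].

Context d (T : measurableType d) (P : probability T R).

Definition standardize (Y : T -> R) (w : T) : R :=
  (Y w - fine 'E_P[Y]) / Num.sqrt (fine 'V_P[Y]).

Definition standardized_moment (Y : T -> R) (k : nat) : R :=
  fine 'E_P[fun w => standardize Y w ^+ k].

Definition standardized_mean n (Y : 'I_n -> {RV P >-> R}) (w : T) : R :=
  n%:R `^ (- 2^-1) * \sum_(i < n) standardize (Y i) w.

Definition mutually_independent (I : finType) (X : I -> {RV P >-> R}) :=
  forall (J : {set I}) (B : I -> set R), (forall i, measurable (B i)) ->
  P (\bigcap_(i in [set i | i \in J]) (X i @^-1` B i)) =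
  (\prod_(i in J) P (X i @^-1` B i))%E.

Definition random_sample d0 (T0 : measurableType d0) (P0 : probability T0 R)
    (Y : {RV P0 >-> R}) n (Ys : 'I_n -> {RV P >-> R}) :=
  mutually_independent Ys /\
  forall i (B : set R), measurable B -> P (Ys i @^-1` B) = P0 (Y @^-1` B).

End Statistics.

(* With h = n^(-1/2) and k_r the cumulants of the standardized variable, the
   standardized mean has log-moment generating function
     t^2/2 + \sum_(j >= 1) k_(j+2) / (j+2)! h^j t^(j+2),
   so its formal Edgeworth series is \sum_j h^j P_j(-D) Phi, where P_j(t) is
   the coefficient of h^j in exp(\sum_(j >= 1) k_(j+2) / (j+2)! h^j t^(j+2)).
   The Cornish-Fisher series is the formal power series in h
     x(z) = \sum_(j >= 1) R_j(z) h^(j-1),   R_1(z) = z,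
   such that \sum_j h^j P_j(-D) Phi(x(z)) = Phi(z).
   Elements of {poly {poly R}} below are polynomials in h. *)
Section CornishFisher.
Context {R : realType}.
Variable m : nat -> R. (* moments m_k of the standardized variable *)

(* k_r = r! [t^r] log(1 + \sum_(k >= 1) m_k t^k / k!) *)
Definition cumulant (r : nat) : R :=
  r`!%:R * (\sum_(1 <= l < r.+1) ((-1) ^+ l.-1 / l%:R) *:
    (\sum_(1 <= k < r.+1) (m k / k`!%:R) *: 'X^k) ^+ l)`_r.

Definition edgeworth_exponent (J : nat) : {poly {poly R}} :=
  \sum_(1 <= j < J.+1) ((cumulant j.+2 / (j.+2)`!%:R) *: 'X^(j.+2)) *: 'X^j.

Definition edgeworth (j : nat) : {poly R} :=
  (\sum_(l < j.+1) (l`!%:R^-1 : R)%:P *: edgeworth_exponent j ^+ l)`_j.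

Fixpoint hermite (k : nat) : {poly R} :=
  if k is k'.+1 then 'X * hermite k' - (hermite k')^`() else 1.

(* (-D)^k Phi = (neg_deriv_Phi k) Phi' for k >= 1; the case k = 0 accounts for
   Phi(z) being subtracted in `edgeworth_residual` *)
Definition neg_deriv_Phi (k : nat) : {poly R} :=
  if k is k'.+1 then - hermite k' else 0.

(* (\sum_j h^j P_j(-D) Phi(z + s) - Phi(z)) / Phi'(z) up to order J in h, using
   Phi^(k)(z + s) = \sum_l s^l / l! Phi^(k+l)(z), for s divisible by h *)
Definition edgeworth_residual (J : nat) (s : {poly {poly R}}) :
    {poly {poly R}} :=
  \sum_(j < J.+1) \sum_(l < J.+1) \sum_(k < size (edgeworth j))
    (((-1) ^+ l / l`!%:R * (edgeworth j)`_k) *: neg_deriv_Phi (k + l)) *: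
      (s ^+ l * 'X^j).

(* The series x(z) up to order J in h. Adding c h^J to s adds c to the
   coefficient of h^J in the residual. *)
Fixpoint cornish_fisher_series (J : nat) : {poly {poly R}} :=
  if J is J'.+1 then
    let x := cornish_fisher_series J' in
    x - (edgeworth_residual J (x - 'X%:P))`_J *: 'X^J
  else 'X%:P.

Definition cornish_fisher (j : nat) : {poly R} :=
  (cornish_fisher_series j.-1)`_j.-1.

Definition cornish_fisher_approx (J n : nat) (u : R) : R :=
  \sum_(1 <= j < J.+1)
    (cornish_fisher j).[normal_quantile u] / n%:R `^ (j.-1%:R / 2).

End CornishFisher.

(* The general recursion gives back the usual closed forms of R_1, R_2, R_3,
   with skewness m_3 and excess kurtosis m_4 - 3. *)
Section FirstCornishFisher.
Context {R : realType}.
Variable m : nat -> R.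
Local Notation cumulant := (cumulant m).
Local Notation edgeworth := (edgeworth m).
Local Notation edgeworth_residual := (edgeworth_residual m).
Local Notation cornish_fisher_series := (cornish_fisher_series m).
Local Notation cornish_fisher := (cornish_fisher m).

Let big3 (V : nmodType) (F : nat -> V) :
  \sum_(1 <= i < 4) F i = F 1%N + F 2%N + F 3%N.
Proof. by do 3! rewrite big_nat_recr//=; rewrite big_geq// add0r. Qed.

Let big4 (V : nmodType) (F : nat -> V) :
  \sum_(1 <= i < 5) F i = F 1%N + F 2%N + F 3%N + F 4%N.
Proof. by rewrite big_nat_recr//= big3. Qed.

Lemma cumulant3 : m 1%N = 0 -> cumulant 3 = m 3%N.
Proof.
move=> m1; rewrite /cumulant !big3 m1 mul0r scale0r add0r -!mul_polyC.
set a := (_ / 2`!%:R)%:P; set b := (_ / 3`!%:R)%:P.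
have -> c1 c2 c3 : c1 * (a * 'X^2 + b * 'X^3) ^+ 1 +
    c2 * (a * 'X^2 + b * 'X^3) ^+ 2 + c3 * (a * 'X^2 + b * 'X^3) ^+ 3 =
  c1 * a * 'X^2 + c1 * b * 'X^3 +
  (c2 * (a + b * 'X) ^+ 2 + c3 * 'X^2 * (a + b * 'X) ^+ 3) * 'X^4 by ring.
rewrite !coefD !coefMXn ltnn subnn -!polyCM !coefC.
have -> : (3 < 2)%N = false by [].
have -> : (3 < 4)%N = true by [].
have -> : (3 - 2 == 0)%N = false by [].
have -> : 3`! = 6%N by [].
rewrite add0r addr0 /= ?expr0 ?divr1 ?mul1r.
by field; rewrite ?pnatr_eq0.
Qed.

Lemma cumulant4 : m 1%N = 0 -> m 2%N = 1 -> cumulant 4 = m 4%N - 3.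
Proof.
move=> m1 m2; rewrite /cumulant !big4 m1 m2 mul0r scale0r add0r -!mul_polyC.
set a := (_ / 2`!%:R)%:P; set b := (_ / 3`!%:R)%:P; set d := (_ / 4`!%:R)%:P.
have -> c1 c2 c3 c4 : c1 * (a * 'X^2 + b * 'X^3 + d * 'X^4) ^+ 1 +
    c2 * (a * 'X^2 + b * 'X^3 + d * 'X^4) ^+ 2 +
    c3 * (a * 'X^2 + b * 'X^3 + d * 'X^4) ^+ 3 +
    c4 * (a * 'X^2 + b * 'X^3 + d * 'X^4) ^+ 4 =
  c1 * a * 'X^2 + c1 * b * 'X^3 + (c1 * d + c2 * (a * a)) * 'X^4 +
  (c2 * (2 * a * (b + d * 'X) + 'X * (b + d * 'X) ^+ 2) +
   c3 * 'X * (a + b * 'X + d * 'X^2) ^+ 3 +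
   c4 * 'X^3 * (a + b * 'X + d * 'X^2) ^+ 4) * 'X^5 by ring.
rewrite !coefD !coefMXn ltnn subnn -!polyCM !coefD !coefC.
have -> : (4 < 2)%N = false by [].
have -> : (4 < 3)%N = false by [].
have -> : (4 < 5)%N = true by [].
have -> : (4 - 2 == 0)%N = false by [].
have -> : (4 - 3 == 0)%N = false by [].
have -> : 4`! = 24%N by [].
have -> : 2`! = 2%N by [].
rewrite !add0r addr0 /= ?expr0 ?divr1 ?mul1r.
by field; rewrite ?pnatr_eq0.
Qed.

Lemma edgeworth0 : edgeworth 0 = 1.
Proof. by rewrite /edgeworth big_ord1 expr0 invr1 scale1r coefC. Qed.

Lemma edgeworth1 : edgeworth 1 = (cumulant 3 / 6) *: 'X^3.
Proof.
rewrite /edgeworth /edgeworth_exponent big_nat1 !big_ord_recr big_ord0 /=.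
rewrite add0r expr0 !expr1 invr1 !scale1r coefD coefZ coefX !coefC /=.
by rewrite add0r mulr1.
Qed.

Lemma edgeworth2 : edgeworth 2 =
  (cumulant 4 / 24) *: 'X^4 + (cumulant 3 ^+ 2 / 72) *: 'X^6.
Proof.
have c1 (a b : {poly R}) : (a *: 'X + b *: 'X^2)`_2 = b.
  by rewrite coefD !coefZ coefX coefXn /= mulr0 mulr1 add0r.
have c2 (a b : {poly R}) : ((a *: 'X + b *: 'X^2) ^+ 2)`_2 = a ^+ 2.
  rewrite -!mul_polyC (_ : (a%:P * 'X + b%:P * 'X^2) ^+ 2 =
    a%:P ^+ 2 * 'X^2 + (2 * a%:P * b%:P + b%:P ^+ 2 * 'X) * 'X^3); last by ring.
  rewrite -rmorphXn /=.
  by rewrite coefD coefCM coefXn coefMXn /= mulr1 addr0.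
rewrite /edgeworth /edgeworth_exponent big_ltn// big_nat1.
rewrite !big_ord_recr big_ord0 /= add0r expr0 !expr1.
rewrite coefD coefD !coefZ c1 c2 coefC /= mulr0 add0r invr1 mul1r.
congr (_ + _); rewrite exprZn -exprM -mul_polyC -!mul_polyC mulrA -polyCM.
by congr (_%:P * _); rewrite (_ : 3`! = 6%N)// (_ : 2`! = 2%N)//; field.
Qed.

Let L (p : {poly R}) l : {poly R} :=
  \sum_(k < size p) p`_k *: neg_deriv_Phi (k + l).

Let L_widen (p : {poly R}) l N : (size p <= N)%N ->
  L p l = \sum_(k < N) p`_k *: neg_deriv_Phi (k + l).
Proof.
move=> pN; rewrite /L (big_ord_widen N (fun k => p`_k *: neg_deriv_Phi (k + l)))//.
rewrite big_mkcond; apply: eq_bigr => k _; case: ifPn => //.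
by rewrite -leqNgt => ?; rewrite nth_default// scale0r.
Qed.

Let LD (p q : {poly R}) l : L (p + q) l = L p l + L q l.
Proof.
rewrite !(@L_widen _ _ (maxn (size p) (size q))) ?leq_maxl ?leq_maxr ?size_polyD//.
by rewrite -big_split; apply: eq_bigr => k _; rewrite coefD scalerDl.
Qed.

Let LXn a n l : L (a *: 'X^n) l = a *: neg_deriv_Phi (n + l).
Proof.
rewrite (@L_widen _ _ n.+1); last by rewrite (leq_trans (size_scale_leq _ _))// size_polyXn.
rewrite big_ord_recr /= coefZ coefXn eqxx mulr1 big1 ?add0r// => k _.
by rewrite coefZ coefXn (ltn_eqF (ltn_ord k)) mulr0 scale0r.
Qed.

Let L1 l : L 1 l = neg_deriv_Phi l.
Proof. by have := LXn 1 0 l; rewrite expr0 !scale1r add0n. Qed.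

Let coef_term (c r : {poly R}) l j J :
  (c *: ((r *: 'X) ^+ l * 'X^j))`_J = c * r ^+ l * (J == l + j)%N%:R.
Proof.
rewrite -(mul_polyC r) exprMn -[in LHS]mulrA -exprD -rmorphXn coefZ /=.
by rewrite coefCM coefXn mulrA.
Qed.

Let residual_coef J (r : {poly R}) : (edgeworth_residual J (r *: 'X))`_J =
  \sum_(j < J.+1) ((-1) ^+ (J - j) / (J - j)`!%:R) *: L (edgeworth j) (J - j) * r ^+ (J - j).
Proof.
rewrite /edgeworth_residual coef_sum; apply: eq_bigr => j _.
rewrite coef_sum (bigD1 (inord (J - j)))//= inordK ?ltnS ?leq_subr//.
rewrite [X in _ + X]big1 ?addr0.
  rewrite coef_sum /L scaler_sumr mulr_suml; apply: eq_bigr => k _.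
  by rewrite coef_term subnK -1?ltnS// eqxx mulr1 scalerA.
move=> l lJ; rewrite coef_sum big1// => k _.
rewrite coef_term; case: eqP => [E|]; last by rewrite mulr0.
by case/eqP: lJ; rewrite [X in (X - _)%N]E addnK inord_val.
Qed.

Lemma cornish_fisher1 : cornish_fisher 1 = 'X.
Proof. by rewrite /cornish_fisher /= coefC. Qed.

Let series1 : cornish_fisher_series 1 = 'X%:P + ((cumulant 3 / 6) *: ('X^2 - 1)) *: 'X.
Proof.
have -> : cornish_fisher_series 1 =
    'X%:P - (edgeworth_residual 1 (0 *: 'X))`_1 *: 'X.
  by rewrite scale0r /= subrr.
rewrite residual_coef !big_ord_recr big_ord0 /=.
rewrite subnn subn0 add0r expr0 !expr1 edgeworth0 edgeworth1 LXn mulr0.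
rewrite add0r mulr1 invr1 mul1r scale1r -scaleNr; congr (_ + _ *: _).
rewrite -scalerN; congr (_ *: _).
by rewrite /= opprK mulr1 derivC subr0 derivX expr2.
Qed.

Lemma cornish_fisher2 : m 1%N = 0 ->
  cornish_fisher 2 = (m 3%N / 6) *: ('X^2 - 1).
Proof.
move=> m1; rewrite -(cumulant3 m1) /cornish_fisher [2.-1]/= series1.
by rewrite coefD coefC coefZ coefX add0r mulr1.
Qed.

Lemma hermiteS k : hermite k.+1 = 'X * hermite k - (hermite k)^`() :> {poly R}.
Proof. by []. Qed.

Lemma neg_deriv_PhiS k : neg_deriv_Phi k.+1 = - hermite k :> {poly R}.
Proof. by []. Qed.

Lemma hermite1 : hermite 1 = 'X :> {poly R}.
Proof. by rewrite hermiteS /= derivC mulr1 subr0. Qed.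

Lemma hermite2 : hermite 2 = 'X^2 - 1 :> {poly R}.
Proof. by rewrite hermiteS hermite1 derivX expr2. Qed.

Lemma hermite3 : hermite 3 = 'X^3 - 'X *+ 3 :> {poly R}.
Proof. by rewrite hermiteS hermite2 derivB derivXn derivC /=; ring. Qed.

Lemma hermite4 : hermite 4 = 'X^4 - 'X^2 *+ 6 + 3 :> {poly R}.
Proof.
by rewrite hermiteS hermite3 derivB derivMn derivXn derivX /=; ring.
Qed.

Lemma hermite5 : hermite 5 = 'X^5 - 'X^3 *+ 10 + 'X *+ 15 :> {poly R}.
Proof.
rewrite hermiteS hermite4 derivD derivB derivMn !derivXn -polyC_natr derivC /=.
by ring.
Qed.

Lemma cornish_fisher3 : m 1%N = 0 -> m 2%N = 1 ->
  cornish_fisher 3 = 72^-1 *: ((3 * (m 4%N - 3)) *: ('X^3 - 3 *: 'X)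
    - (2 * m 3%N ^+ 2) *: (2 *: 'X^3 - 5 *: 'X)).
Proof.
move=> m1 m2; rewrite -(cumulant4 m1 m2) -(cumulant3 m1) /cornish_fisher.
have -> : cornish_fisher_series 3.-1 = cornish_fisher_series 1 -
  (edgeworth_residual 2 (cornish_fisher_series 1 - 'X%:P))`_2 *: 'X^2 by [].
rewrite series1; set r := _ *: (_ - 1).
rewrite (_ : 'X%:P + r *: 'X - 'X%:P = r *: 'X); last by rewrite addrC addKr.
rewrite coefB coefD coefC !coefZ coefX coefXn residual_coef [3.-1]/= mulr1 mulr0.
rewrite !big_ord_recr big_ord0 /= add0r subn0 subnn subSnn.
rewrite edgeworth0 edgeworth1 edgeworth2 LD L1 !LXn.
rewrite addn1 !addn0 !neg_deriv_PhiS hermite1 hermite3 hermite5.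
have f0 : 0`! = 1%N by [].
have f1 : 1`! = 1%N by [].
have f2 : 2`! = 2%N by [].
rewrite f0 f1 f2 !expr0 !expr1 sqrrN expr1n !divr1 {f0 f1 f2}.
set g := cumulant 3 / 12; set e := cumulant 4 / 24.
have E1 : cumulant 3 / 6 = 2 * g by rewrite /g; field.
have E2 : cumulant 3 ^+ 2 / 72 = 2 * g ^+ 2 by rewrite /g; field.
have E3 : 1 / 2 * (2 * g) ^+ 2 = 2 * g ^+ 2 by field.
have E4 : 72^-1 * (3 * cumulant 4) = e by rewrite /e; field.
have E5 : 72^-1 * (2 * cumulant 3 ^+ 2) = 4 * g ^+ 2 by rewrite /g; field.
clearbody g e; rewrite scalerBr !scalerA E4 E5 {}/r E1 E2.
rewrite exprZn -scalerAl -scalerAr scalerA E3.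
rewrite -!mul_polyC !(polyCM, polyCN, rmorphXn, polyC1) /=.
by rewrite !polyC_natr; ring.
Qed.

End FirstCornishFisher.

(* Main.v *)
(* Write D = ]a, b], let f be increasing and g* be the rearrangement of g.  For
   p >= 1 and psi(z) = p z^(p-1) 1{z > 0},
     |x - y|^p = \int_s (1{s < x} psi(s - y) + 1{x <= s} psi(y - s)) ds,
   so by Tonelli \int_D |g - f|^p is an integral over the levels s of a
   quantity which depends on g only through E = {g > s}.  Replacing g by g*
   replaces E by the final segment F = ]c, b] of D of the same measure, and
   changes the integrand at u by (1_F - 1_E)(u) K(f u), where
   K(y) = psi(s - y) - psi(y - s) is nonincreasing.  Hence the change is at most
   (1_F - 1_E)(u) K(f c), whose integral vanishes.  If p > 1 then K is strictly
   decreasing and the loss at level s is strict as soon as F \ E is not null.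
   This happens for all s in some interval unless g = g* almost everywhere,
   which is impossible when g decreases over a set of positive measure.
   For p = oo the same argument with psi = 1{z > M} shows that |g - f| <= M
   almost everywhere implies |g* - f| <= M almost everywhere. *)
Require Import Defs.
From HB Require Import structures.
From mathcomp Require Import all_boot all_order all_algebra.
From mathcomp Require Import all_classical all_reals all_analysis.
From mathcomp Require Import measurable_realfun ess_sup_inf ring lra.

Set Implicit Arguments.
Unset Strict Implicit.
Unset Printing Implicit Defensive.

Import Order.TTheory GRing.Theory Num.Theory.
Import numFieldNormedType.Exports.

Local Open Scope classical_set_scope.
Local Open Scope ring_scope.

(** * Strict comparison of integrals, and exchange of sets of equal measure *)

Section StrictIntegral.
Context d (T : measurableType d) (R : realType).
Variables (m : {measure set T -> \bar R}) (D : set T).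
Hypothesis mD : measurable D.
Local Open Scope ereal_scope.

(** Split [f2] as [f1 + (f2 - f1)]. As the integral of [f1] is finite, equality would make [f2 - f1]
    vanish almost everywhere, hence somewhere on [A]. *)
Lemma ge0_lt_integral (f1 f2 : T -> \bar R) (A : set T) :
  measurable_fun D f1 -> measurable_fun D f2 ->
  (forall x, D x -> 0 <= f1 x) -> (forall x, D x -> f1 x \is a fin_num) ->
  (forall x, D x -> f1 x <= f2 x) -> \int[m]_(x in D) f1 x < +oo ->
  measurable A -> A `<=` D -> 0 < m A -> (forall x, A x -> f1 x < f2 x) ->
  \int[m]_(x in D) f1 x < \int[m]_(x in D) f2 x.
Proof.
move=> mf1 mf2 f10 f1fin f12 If1 mA AD mA0 f12A.
have mB : measurable_fun D (f2 \- f1) by exact: emeasurable_funB.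
have B0 x : D x -> 0 <= (f2 \- f1) x by move=> Dx; rewrite sube_ge0 ?f12 ?f1fin.
have -> : \int[m]_(x in D) f2 x =
    \int[m]_(x in D) f1 x + \int[m]_(x in D) (f2 \- f1) x.
  rewrite -ge0_integralD//; apply: eq_integral => x /set_mem Dx.
  by rewrite addeC subeK ?f1fin.
rewrite lteDl; last by rewrite ge0_fin_numE// integral_ge0.
rewrite lt_neqAle integral_ge0// andbT eq_sym.
apply/negP => /eqP I0.
have /ae_eq_integral_abs[//|//|N [mN N0 ANB]] :
    \int[m]_(x in D) `|(f2 \- f1) x| = 0.
  by rewrite -[RHS]I0; apply: eq_integral => x /set_mem Dx; rewrite gee0_abs// B0.
suff : m A <= 0 by rewrite leNgt mA0.
rewrite -N0 le_measure ?inE// => x Ax; apply: ANB => /= /(_ (AD _ Ax)).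
by apply/eqP; rewrite gt_eqF// sube_gt0 f12A.
Qed.

(** After integration of the pointwise bound the two terms in [kap] cancel, because [E] and [F] have
    the same finite measure. *)
Lemma le_integral_swap (h1 h2 : T -> R) (E F : set T) (kap : R) :
  m D < +oo -> measurable_fun D h1 -> measurable_fun D h2 ->
  (forall x, D x -> (0 <= h1 x)%R) -> (forall x, D x -> (0 <= h2 x)%R) ->
  measurable E -> measurable F -> E `<=` D -> F `<=` D -> m E = m F ->
  (forall x, D x -> (h2 x + kap * \1_E x <= h1 x + kap * \1_F x)%R) ->
  \int[m]_(x in D) (h2 x)%:E <= \int[m]_(x in D) (h1 x)%:E /\
  (\int[m]_(x in D) (h2 x)%:E < +oo -> forall A, measurable A -> A `<=` D ->
   0 < m A ->
   (forall x, A x -> (h2 x + kap * \1_E x < h1 x + kap * \1_F x)%R) ->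
   \int[m]_(x in D) (h2 x)%:E < \int[m]_(x in D) (h1 x)%:E).
Proof.
move=> Doo mh1 mh2 h10 h20 mE mF ED FD mEF h12.
(* Since [kap] may be negative, [|kap| (1_E + 1_F)] is added to both sides of the bound. They become
   [h2 + v E F] and [h1 + v F E], with all terms nonnegative. *)
pose c : R := (`|kap| + kap)%R.
have c0 : (0 <= c)%R by rewrite /c -lerBlDr sub0r ler_normr lexx orbT.
pose v (A B : set T) x : R := (c * \1_A x + `|kap| * \1_B x)%R.
have mv A B : measurable A -> measurable B -> measurable_fun D (v A B).
  move=> mA mB; apply: measurable_funD;
    by apply: measurable_funM => //; exact: measurable_indic.
have v0 A B x : D x -> (0 <= v A B x)%R.
  by move=> Dx; rewrite addr_ge0// mulr_ge0.
have Iv A B : measurable A -> measurable B -> A `<=` D -> B `<=` D ->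
    \int[m]_(x in D) (v A B x)%:E = c%:E * m A + `|kap|%:E * m B.
  move=> mA mB AD BD; rewrite /v; under eq_integral do rewrite EFinD 2!EFinM.
  rewrite ge0_integralD//; last 3 first.
  - by move=> x _; rewrite mule_ge0.
  - by apply/measurable_EFinP/measurable_funM => //; exact: measurable_indic.
  - by apply/measurable_EFinP/measurable_funM => //; exact: measurable_indic.
  rewrite !ge0_integralZl_EFin//; last 2 first.
  - by apply/measurable_EFinP; exact: measurable_indic.
  - by apply/measurable_EFinP; exact: measurable_indic.
  by rewrite !integral_indic// !setIidl.
have mFfin : m F \is a fin_num.
  by rewrite ge0_fin_numE// (le_lt_trans _ Doo)// le_measure ?inE.
have Ivfin : \int[m]_(x in D) (v E F x)%:E \is a fin_num.
  by rewrite Iv// mEF fin_numD !fin_numM.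
have IvEF : \int[m]_(x in D) (v F E x)%:E = \int[m]_(x in D) (v E F x)%:E.
  by rewrite !Iv// mEF.
have ID (h : T -> R) (A B : set T) : measurable_fun D h -> (forall x, D x -> (0 <= h x)%R) ->
    measurable A -> measurable B ->
    \int[m]_(x in D) (h x + v A B x)%:E =
    \int[m]_(x in D) (h x)%:E + \int[m]_(x in D) (v A B x)%:E.
  move=> mh h0 mA mB; rewrite -ge0_integralD//.
  - by apply/measurable_EFinP.
  - by move=> x Dx; rewrite lee_fin v0.
  - by apply/measurable_EFinP; exact: mv.
have le12 x : D x -> (h2 x + v E F x <= h1 x + v F E x)%R.
  by move=> /h12; rewrite /v /c; lra.
have mDv (h : T -> R) (A B : set T) : measurable_fun D h -> measurable A -> measurable B ->
    measurable_fun D (EFin \o (fun x => h x + v A B x)%R).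
  move=> mh mA mB; apply/measurable_EFinP/measurable_funD => //; exact: mv.
have D0 (h : T -> R) (A B : set T) x : (forall x, D x -> (0 <= h x)%R) -> D x ->
    0 <= (EFin \o (fun x => h x + v A B x)%R) x.
  by move=> h0 Dx; rewrite lee_fin addr_ge0// ?h0 ?v0.
split.
  rewrite -(leeD2rE _ _ Ivfin) -[X in _ <= _ + X]IvEF -!ID//.
  apply: ge0_le_integral => //.
  - by move=> x Dx; exact: D0.
  - exact: mDv.
  - exact: mDv.
move=> Ioo A mA AD A0 lt12.
rewrite -(lteD2rE _ _ Ivfin) -[X in _ < _ + X]IvEF -!ID//.
apply: (ge0_lt_integral (A := A)) => //.
- exact: mDv.
- exact: mDv.
- by move=> x Dx; exact: D0.
- by rewrite ID// lte_add_pinfty// ltey_eq Ivfin.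
- by move=> x Ax; rewrite lte_fin; move: (lt12 _ Ax); rewrite /v /c; lra.
Qed.

End StrictIntegral.

(** * Pointwise inequalities for the level kernel *)

Section Kernel.
Context {R : realType}.
Implicit Types (psi : R -> R) (s x y : R).

(** When [psi] vanishes on nonpositive numbers, only levels between [x] and [y] contribute, and the
    integral over [s] is that of [psi] from 0 to [|x - y|]. *)
Definition level_kernel psi s x y : R := if s < x then psi (s - y) else psi (y - s).

Lemma level_kernel_ge0 psi : (forall x, 0 <= psi x) ->
  forall s x y, 0 <= level_kernel psi s x y.
Proof. by move=> psi0 s x y; rewrite /level_kernel; case: ifP. Qed.

Lemma measurable_level_kernel psi : {homo psi : x y / x <= y} ->
  forall d (T : measurableType d) (s x y : T -> R),
  measurable_fun [set: T] s -> measurable_fun [set: T] x ->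
  measurable_fun [set: T] y ->
  measurable_fun [set: T] (fun t => level_kernel psi (s t) (x t) (y t)).
Proof.
move=> psi_nd d T s x y ms mx my.
have mpsi : measurable_fun [set: R] psi by exact: nondecreasing_measurable.
apply: measurable_fun_ifT; first exact: measurable_fun_ltr.
- by apply: measurableT_comp => //; exact: measurable_funB.
- by apply: measurableT_comp => //; exact: measurable_funB.
Qed.

(* [level_kernel psi s x y - level_kernel psi s x' y] depends on [x] and [x']
   only through [s < x] and [s < x'], and is nonincreasing in [y] when
   [x' <= s < x]. *)
Lemma level_kernel_swap psi s k x x' y (b b' : bool) :
  {homo psi : x y / x <= y} -> b = (s < x) -> b' = (s < x') ->
  (b -> ~~ b' -> y <= k) -> (~~ b -> b' -> k <= y) ->
  level_kernel psi s x' y + (psi (s - k) - psi (k - s)) * b%:R <=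
  level_kernel psi s x y + (psi (s - k) - psi (k - s)) * b'%:R.
Proof.
move=> nd be be'; rewrite /level_kernel -be -be'.
case: b {be}; case: b' {be'} => //= h1 h2.
- have {}h1 := h1 isT isT.
  have : psi (s - k) <= psi (s - y) by apply: nd; lra.
  have : psi (y - s) <= psi (k - s) by apply: nd; lra.
  by lra.
- have {}h2 := h2 isT isT.
  have : psi (s - y) <= psi (s - k) by apply: nd; lra.
  have : psi (k - s) <= psi (y - s) by apply: nd; lra.
  by lra.
Qed.

(** Of [psi (s - y) <= psi (s - k)] and [psi (k - s) <= psi (y - s)] at least one is strict. Strict
    growth of [psi] is assumed from 0 onwards only, whence the cases [y <= s], [s <= k] and
    [k < s < y]. *)
Lemma level_kernel_swap_lt psi s k x x' y :
  {homo psi : x y / x <= y} -> (forall x y, 0 <= x -> x < y -> psi x < psi y) ->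
  x <= s -> s < x' -> k < y ->
  level_kernel psi s x' y <
  level_kernel psi s x y + (psi (s - k) - psi (k - s)).
Proof.
move=> nd lt xs sx' ky; rewrite /level_kernel sx' (ltNge s x) xs /=.
have : psi (s - y) <= psi (s - k) by apply: nd; lra.
have : psi (k - s) <= psi (y - s) by apply: nd; lra.
have [ys|sy] := leP y s.
  have : psi (s - y) < psi (s - k) by apply: lt; lra.
  by lra.
have [sk|ks] := leP s k.
  have : psi (k - s) < psi (y - s) by apply: lt; lra.
  by lra.
have : psi (k - s) <= psi 0 by apply: nd; lra.
have : psi 0 < psi (y - s) by apply: lt; lra.
by lra.
Qed.

End Kernel.

(** * Tonelli over the levels, and exchange of superlevel sets *)

Section Exchange.
Context d (T : measurableType d) (R : realType).
Variables (m : {sigma_finite_measure set T -> \bar R}) (D : set T).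
Hypotheses (mD : measurable D) (Doo : (m D < +oo)%E).
Variable psi : R -> R.
Hypotheses (psi_nd : {homo psi : x y / x <= y}) (psi0 : forall x, 0 <= psi x).
Local Notation mu := (@lebesgue_measure R).
Local Notation K := (level_kernel psi).

(** The indicator of [D] turns integrals over [D] into integrals over the whole space, the form in
    which Tonelli's theorem is applied. *)
Let KD (f g : T -> R) (z : T * R) : \bar R :=
  (\1_D z.1 * K z.2 (g z.1) (f z.1))%:E.

Let KD_ge0 f g z : (0 <= KD f g z)%E.
Proof. by rewrite lee_fin mulr_ge0// level_kernel_ge0. Qed.

Let mKD (f g : T -> R) : measurable_fun [set: T] f ->
  measurable_fun [set: T] g -> measurable_fun [set: T * R] (KD f g).
Proof.
move=> mf mg; apply/measurable_EFinP/measurable_funM.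
  have mD1 : measurable_fun [set: T] (\1_D : T -> R) by exact: measurable_indic.
  exact: (measurableT_comp mD1 measurable_fst).
by apply: measurable_level_kernel => //; exact: measurableT_comp.
Qed.

Lemma integral_kernelC (f g : T -> R) :
  measurable_fun [set: T] f -> measurable_fun [set: T] g ->
  (\int[m]_(u in D) \int[mu]_s (K s (g u) (f u))%:E =
   \int[mu]_s \int[m]_(u in D) (K s (g u) (f u))%:E)%E.
Proof.
move=> mf mg; have mh := mKD mf mg; have h0 := KD_ge0 f g.
transitivity (\int[m]_u \int[mu]_s KD f g (u, s))%E.
  rewrite integral_mkcond; apply: eq_integral => u _.
  rewrite patchE /KD/= indicE; case: ifPn => uD.
    by apply: eq_integral => s _; rewrite mul1r.
  by under eq_integral do rewrite mul0r; rewrite integral0.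
rewrite fubini_tonelli//; apply: eq_integral => s _.
rewrite [RHS]integral_mkcond; apply: eq_integral => u _.
by rewrite patchE /KD/= indicE; case: ifPn => uD; rewrite ?mul1r ?mul0r.
Qed.

Lemma measurable_int_kernel1 (f g : T -> R) :
  measurable_fun [set: T] f -> measurable_fun [set: T] g ->
  measurable_fun D (fun u => \int[mu]_s (K s (g u) (f u))%:E)%E.
Proof.
move=> mf mg; have mh := mKD mf mg; have h0 := KD_ge0 f g.
apply/measurable_restrictT => //.
rewrite (_ : _ \_ _ = fubini_F mu (KD f g)).
  exact: measurable_fun_fubini_tonelli_F.
apply/funext => u; rewrite patchE /fubini_F /KD/= indicE; case: ifPn => uD.
  by apply: eq_integral => s _; rewrite mul1r.
by under eq_integral do rewrite mul0r; rewrite integral0.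
Qed.

Lemma measurable_int_kernel (f g : T -> R) :
  measurable_fun [set: T] f -> measurable_fun [set: T] g ->
  measurable_fun [set: R] (fun s => \int[m]_(u in D) (K s (g u) (f u))%:E)%E.
Proof.
move=> mf mg; have mh := mKD mf mg; have h0 := KD_ge0 f g.
rewrite (_ : (fun s => _) = fubini_G m (KD f g)).
  exact: measurable_fun_fubini_tonelli_G.
apply/funext => s; rewrite [LHS]integral_mkcond; apply: eq_integral => u _.
by rewrite patchE /KD/= indicE; case: ifPn => uD; rewrite ?mul1r ?mul0r.
Qed.

Variables (f g g' : T -> R) (kappa : R -> R).
Hypotheses (mf : measurable_fun [set: T] f) (mg : measurable_fun [set: T] g)
  (mg' : measurable_fun [set: T] g').
Let E s := D `&` [set u | s < g u].
Let F s := D `&` [set u | s < g' u].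
Hypothesis EF : forall s, m (E s) = m (F s).
Hypothesis Ekappa : forall s u, D u -> s < g u -> g' u <= s -> f u <= kappa s.
Hypothesis Fkappa : forall s u, D u -> g u <= s -> s < g' u -> kappa s <= f u.

Let mlevel (h : T -> R) s : measurable_fun [set: T] h ->
  measurable (D `&` [set u | s < h u]).
Proof.
move=> mh; apply: measurableI => //.
have := mh measurableT `]s, +oo[%classic (measurable_itv _); rewrite setTI.
by congr measurable; apply/seteqP; split => u /=; rewrite in_itv/= andbT.
Qed.

Let levelE (h : T -> R) s u : D u ->
  \1_(D `&` [set u | s < h u]) u = (s < h u)%R%:R :> R.
Proof.
move=> Du; rewrite indicE; congr (nat_of_bool _)%:R.
by apply/idP/idP => [/set_mem[]//|su]; apply/mem_set.
Qed.

(** This is [le_integral_swap] with weight [psi (s - kappa s) - psi (kappa s - s)], the effect of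
    the exchange at a point where [f] equals [kappa s]. In the application [g'] is the rearrangement
    of [g] and [kappa s] is the value of [f] at the left end of [F s]. *)
Lemma le_int_kernel s : (\int[m]_(u in D) (K s (g' u) (f u))%:E <=
  \int[m]_(u in D) (K s (g u) (f u))%:E)%E /\
  ((\int[m]_(u in D) (K s (g' u) (f u))%:E < +oo)%E ->
   (forall x y, 0 <= x -> x < y -> psi x < psi y) ->
   (0 < m (F s `\` E s))%E ->
   (forall u, D u -> s < g' u -> g u <= s -> kappa s < f u) ->
   (\int[m]_(u in D) (K s (g' u) (f u))%:E <
    \int[m]_(u in D) (K s (g u) (f u))%:E)%E).
Proof.
have mK (h : T -> R) : measurable_fun [set: T] h ->
    measurable_fun D (fun u => K s (h u) (f u)).
  by move=> mh; apply: measurable_funTS; exact: measurable_level_kernel.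
have K0 (h : T -> R) u : D u -> 0 <= K s (h u) (f u).
  by move=> _; exact: level_kernel_ge0.
have mE : measurable (E s) by exact: mlevel.
have mF : measurable (F s) by exact: mlevel.
have [] := @le_integral_swap _ _ _ m D mD (fun u => K s (g u) (f u))
  (fun u => K s (g' u) (f u)) (E s) (F s)
  (psi (s - kappa s) - psi (kappa s - s)) Doo (mK _ mg) (mK _ mg')
  (K0 _) (K0 _) mE mF _ _ (EF s).
- by move=> ? [].
- by move=> ? [].
- move=> u Du; rewrite !levelE//; apply: level_kernel_swap => //.
  + by rewrite -leNgt; exact: Ekappa.
  + by rewrite -leNgt; exact: Fkappa.
move=> le lt; split => // oo psi_lt FE0 kf.
apply: (lt oo (F s `\` E s)) => //.
- exact: measurableD.
- by move=> u [[]].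
move=> u [[Du sg'] nE].
have gs : g u <= s by rewrite leNgt; apply/negP => sg; exact: nE.
rewrite !levelE// (ltNge s (g u)) gs sg'/= mulr0 mulr1 addr0.
by apply: level_kernel_swap_lt => //; exact: kf.
Qed.

Lemma le_int2_kernel : (\int[m]_(u in D) \int[mu]_s (K s (g' u) (f u))%:E <=
  \int[m]_(u in D) \int[mu]_s (K s (g u) (f u))%:E)%E.
Proof.
rewrite !integral_kernelC//; apply: ge0_le_integral => //.
- by move=> s _; apply: integral_ge0 => u _; rewrite lee_fin level_kernel_ge0.
- exact: measurable_int_kernel.
- exact: measurable_int_kernel.
by move=> s _; exact: (le_int_kernel s).1.
Qed.

(** [S] is a set of levels at which the inequality is strict; having positive measure, it makes the
    integral over all levels strict. *)
Lemma lt_int2_kernel (B : R) (S : set R) :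
  (forall x y, 0 <= x -> x < y -> psi x < psi y) ->
  (forall u, D u -> `|f u| <= B) ->
  measurable S -> (0 < mu S)%E ->
  (forall s, S s -> (0 < m (F s `\` E s))%E) ->
  (forall s u, D u -> s < g' u -> g u <= s -> kappa s < f u) ->
  (\int[m]_(u in D) \int[mu]_s (K s (g u) (f u))%:E < +oo)%E ->
  (\int[m]_(u in D) \int[mu]_s (K s (g' u) (f u))%:E <
   \int[m]_(u in D) \int[mu]_s (K s (g u) (f u))%:E)%E.
Proof.
move=> psi_lt fB mS S0 FE kf oo.
have {}oo := le_lt_trans le_int2_kernel oo.
(* Both arguments that [psi] can receive, [s - f u] and [f u - s], are at most [|s| + B], and [D]
   has finite measure. *)
have lev_fin s : (\int[m]_(u in D) (K s (g' u) (f u))%:E < +oo)%E.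
  apply: (@le_lt_trans _ _ (\int[m]_(u in D) (psi (`|s| + B))%:E)%E); last first.
    by rewrite integral_cst//= lte_mul_pinfty// lee_fin.
  apply: ge0_le_integral => //.
  - by move=> u _; rewrite lee_fin level_kernel_ge0.
  - apply/measurable_EFinP; apply: measurable_funTS; exact: measurable_level_kernel.
  move=> u Du; rewrite lee_fin /level_kernel; have := fB _ Du; rewrite ler_norml => /andP[B1 B2].
  have s1 := ler_norm s; have s2 := ler_norm (- s); rewrite normrN in s2.
  by case: ifP => _; apply: psi_nd; lra.
move: oo; rewrite !integral_kernelC// => oo.
apply: (@ge0_lt_integral _ _ _ mu setT measurableT _ _ S) => //.
- exact: measurable_int_kernel.
- exact: measurable_int_kernel.
- by move=> s _; apply: integral_ge0 => u _; rewrite lee_fin level_kernel_ge0.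
- move=> s _; rewrite ge0_fin_numE//.
  by apply: integral_ge0 => u _; rewrite lee_fin level_kernel_ge0.
- by move=> s _; exact: (le_int_kernel s).1.
move=> s Ss; apply: (le_int_kernel s).2 => //; first exact: FE.
exact: kf.
Qed.

End Exchange.

(** * Affine substitutions, and the kernels for finite and infinite exponents *)

Section PowerKernel.
Context {R : realType}.
Local Notation mu := (@lebesgue_measure R).
Implicit Types (p x y z t : R).

Definition affine (c k t : R) : R := c + k * t.

Lemma measurable_affine c k :
  measurable_fun [set: measurableTypeR R] (affine c k : _ -> measurableTypeR R).
Proof. by apply: measurable_funD => //; exact: measurable_funM. Qed.

(** The scaled pushforward on the right is a measure that agrees with [mu] on half-open intervals,
    so uniqueness of Lebesgue measure applies. *)
Lemma lebesgue_measure_affine (c k : R) (A : set R) : k != 0 -> measurable A ->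
  mu A = (`|k|%:E * mu (affine c k @^-1` A))%E.
Proof.
move=> k0 mA.
pose nu : {measure set (measurableTypeR R) -> \bar R} := mscale (NngNum (normr_ge0 k))
  (pushforward mu (affine c k : measurableTypeR R -> measurableTypeR R)).
pose nu' : {measure set (measurableTypeR R) -> \bar R} := nu (measurable_affine c k).
suff nuE : forall X, ocitv X -> mu X = nu' X.
  exact: (lebesgue_measure_unique nuE mA).
move=> _ [[a b] _ <-].
have -> : nu' `]a, b]%classic = (`|k|%:E * mu (affine c k @^-1` `]a, b]))%E by [].
rewrite /affine.
have /orP[kp|kn] : (0 < k) || (k < 0) by rewrite orbC -neq_lt.
- rewrite (_ : _ @^-1` _ = `](a - c) / k, (b - c) / k]%classic); last first.
    by apply/seteqP; split => t /=; rewrite !in_itv/= ltr_pdivrMr// ler_pdivlMr//;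
      move=> /andP[? ?]; apply/andP; split; lra.
  rewrite !lebesgue_measure_itv/= !lte_fin ltr_pM2r ?invr_gt0// ltrD2r gtr0_norm//.
  case: ifPn; rewrite ?mule0// => _; rewrite -!EFinD -EFinM; congr EFin.
  by rewrite -mulrBl; field.
(* A negative slope reverses the interval, so the closed end is now on the left; the length is the
   same. *)
- rewrite (_ : _ @^-1` _ = `[(b - c) / k, (a - c) / k[%classic); last first.
    by apply/seteqP; split => t /=; rewrite !in_itv/= ltr_ndivlMr// ler_ndivrMr//;
      move=> /andP[? ?]; apply/andP; split; lra.
  rewrite !lebesgue_measure_itv/= !lte_fin ltr_nM2r ?invr_lt0// ltrD2r ltr0_norm//.
  case: ifPn; rewrite ?mule0// => _; rewrite -!EFinD -EFinM; congr EFin.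
  by rewrite -mulrBl; field.
Qed.

Lemma ge0_integral_affine1 (c k : R) (A : set R) (h : R -> \bar R) :
  `|k| = 1 -> measurable A -> measurable_fun A h -> (forall x, A x -> (0 <= h x)%E) ->
  (\int[mu]_(s in A) h s =
   \int[mu]_(t in affine c k @^-1` A) h (c + k * t)%R)%E.
Proof.
move=> k1 mA mh h0.
rewrite -(ge0_integral_pushforward (measurable_affine c k))//; last by move=> x /set_mem; exact: h0.
have k0 : k != 0 by rewrite -normr_gt0 k1.
apply: eq_measure_integral => [|mk B mB _]; first exact: measurable_affine.
by have := lebesgue_measure_affine c k0 mB; rewrite k1 mul1e.
Qed.

Lemma within_continuous_powR p z : 0 <= p -> 0 < z ->
  {within `[0, z], continuous (fun t : R => t `^ p)}.
Proof.
rewrite le_eqVlt => /predU1P[<- _|p0 z0].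
  (* By convention 0 to the power 0 is 1, so exponent 0 gives a constant. [integral_powR] meets this
     case at exponent [p - 1] when [p = 1]. *)
  rewrite (_ : (fun t : R => t `^ 0) = cst 1); last by apply/funext => t; rewrite powRr0.
  by apply: continuous_subspaceT => t; exact: cvg_cst.
have powRc t : 0 < t -> {for t, continuous (fun t : R => t `^ p)}.
  move=> t0; apply: differentiable_continuous; apply/derivable1_diffP.
  by apply: derivable_powR; rewrite in_itv/= t0.
apply/continuous_within_itvP => //; split.
- by move=> t; rewrite in_itv/= => /andP[t0 _]; exact: powRc.
- by rewrite powR0 ?gt_eqF//; exact: powR_cvg0.
- by apply: cvg_at_left_filter; exact: powRc.
Qed.

Lemma integral_powR p z : 1 <= p -> 0 < z ->
  (\int[mu]_(t in `[0%R, z]) (p * t `^ (p - 1))%:E = (z `^ p)%:E)%E.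
Proof.
move=> p1 z0; have p0 : 0 < p by lra.
rewrite (@continuous_FTC2 _ _ (fun t : R => t `^ p))//.
- by rewrite powR0 ?gt_eqF// sube0.
- by move=> t; apply: cvgM; [exact: cvg_cst|apply: within_continuous_powR => //; lra].
- have /continuous_within_itvP[//|_ c0 cz] := within_continuous_powR (ltW p0) z0.
  split => // t; rewrite in_itv/= => /andP[t0 _].
  by apply: derivable_powR; rewrite in_itv/= t0.
- by move=> t; rewrite in_itv/= => /andP[t0 _]; rewrite powR_derive1// in_itv/= t0.
Qed.

Definition powR_kernel p z : R := if 0 < z then p * z `^ (p - 1) else 0.

Lemma powR_kernel_ge0 p z : 1 <= p -> 0 <= powR_kernel p z.
Proof.
by move=> p1; rewrite /powR_kernel; case: ifP => // z0; rewrite mulr_ge0 ?powR_ge0//; lra.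
Qed.

Lemma powR_kernel_nd p : 1 <= p -> {homo powR_kernel p : x y / x <= y}.
Proof.
move=> p1 x y xy; rewrite {1}/powR_kernel; case: ifPn => x0; last exact: powR_kernel_ge0.
rewrite /powR_kernel (lt_le_trans x0 xy) ler_wpM2l//; first lra.
by apply: ge0_ler_powR; rewrite ?nnegrE//; lra.
Qed.

Lemma powR_kernel_lt p x y : 1 < p -> 0 <= x -> x < y ->
  powR_kernel p x < powR_kernel p y.
Proof.
move=> p1 x0 xy; have p0 : 0 < p by lra.
rewrite /powR_kernel (le_lt_trans x0 xy); case: ifPn => _.
  by rewrite ltr_pM2l//; apply: gt0_ltr_powR; rewrite ?nnegrE//; lra.
by rewrite mulr_gt0// powR_gt0//; lra.
Qed.

Lemma measurable_powR_kernel p : 1 <= p -> measurable_fun [set: R] (powR_kernel p).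
Proof. by move=> /powR_kernel_nd; exact: nondecreasing_measurable. Qed.

(** The integrand is carried by []y, x[] if [y < x], by [[x, y[] if [x < y], and is zero if
    [x = y]. *)
Lemma int_kernel_powR p x y : 1 <= p ->
  (\int[mu]_s (level_kernel (powR_kernel p) s x y)%:E = (`|x - y| `^ p)%:E)%E.
Proof.
move=> p1; have p0 : 0 < p by lra.
have mk (c k : R) : measurable_fun [set: R] (fun s => (powR_kernel p (k * (s - c)))%:E).
  apply/measurable_EFinP; apply: measurableT_comp; first exact: measurable_powR_kernel.
  by apply: measurable_funM => //; exact: measurable_funB.
have k0 z : (0 <= (powR_kernel p z)%:E)%E by rewrite lee_fin powR_kernel_ge0.
(* substituting [s = y + k t] brings both cases to [integral_powR] *)
have red (k : R) (A : set R) z b0 b1 : 0 < z -> `|k| = 1 -> k * k = 1 ->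
    measurable A ->
    affine y k @^-1` A = [set` Interval (BSide b0 0) (BSide b1 z)] ->
    (\int[mu]_(s in A) (powR_kernel p (k * (s - y)))%:E = (z `^ p)%:E)%E.
  move=> z0 k1 kk mA eA.
  rewrite (@ge0_integral_affine1 y k)//; last exact: measurable_funTS.
  rewrite -integral_powR// eA.
  under eq_integral do rewrite (addrC y) addrK mulrA kk mul1r.
  (* Passing to the open interval makes the bracket types [b0], [b1] immaterial and leaves only
     [t > 0], where [powR_kernel] takes its first branch. *)
  rewrite [LHS]integral_itv_bndoo; last first.
    by apply/measurable_EFinP/measurable_funTS; exact: measurable_powR_kernel.
  rewrite [RHS]integral_itv_bndoo; last first.
    apply/measurable_EFinP/measurable_funM => //.
    by apply: measurable_funTS; exact: measurable_powR.
  apply: eq_integral => t; rewrite inE/= in_itv/= => /andP[t0 _].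
  by rewrite /powR_kernel t0.
have [yx|xy] := ltP y x.
- transitivity (\int[mu]_(s in `]y, x[) (powR_kernel p (1 * (s - y)))%:E)%E.
    rewrite [RHS]integral_mkcond; apply: eq_integral => s _.
    rewrite patchE mem_setE in_itv/= /level_kernel mul1r.
    have [sx|xs] := ltP s x; rewrite ?andbT ?andbF.
      case: ltP => // sy; rewrite /powR_kernel ifF//.
      by apply/negbTE; rewrite -leNgt; lra.
    by rewrite /powR_kernel ifF//; apply/negbTE; rewrite -leNgt; lra.
  rewrite (red 1 _ (x - y) false true) ?subr_gt0 ?normr1 ?mulr1//.
    by rewrite gtr0_norm ?subr_gt0.
  by apply/seteqP; split => t /=; rewrite /affine !in_itv/= => /andP[? ?];
    apply/andP; split; lra.
have [->|xy'] := eqVneq x y.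
  rewrite subrr normr0 powR0 ?gt_eqF// -[RHS](integral0 mu setT).
  apply: eq_integral => s _; rewrite /level_kernel /powR_kernel.
  by case: ltP => sy; rewrite ifF//; apply/negbTE; rewrite -leNgt; lra.
have {}xy : x < y by rewrite lt_neqAle xy'.
transitivity (\int[mu]_(s in `[x, y[) (powR_kernel p (-1 * (s - y)))%:E)%E.
  rewrite [RHS]integral_mkcond; apply: eq_integral => s _.
  rewrite patchE mem_setE in_itv/= /level_kernel mulN1r opprB.
  have [sx|xs]/= := ltP s x.
    by rewrite /powR_kernel ifF//; apply/negbTE; rewrite -leNgt; lra.
  by case: ltP => // ys; rewrite /powR_kernel ifF//; apply/negbTE; rewrite -leNgt; lra.
rewrite (red (-1) _ (y - x) false false) ?subr_gt0 ?normrN ?normr1 ?mulNr ?mulrN ?mulr1 ?opprK//.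
  by rewrite distrC gtr0_norm ?subr_gt0.
by apply/seteqP; split => t /=; rewrite /affine !in_itv/= => /andP[? ?];
  apply/andP; split; lra.
Qed.

(** The substitute for the power kernel when [p] is infinite: for [M >= 0] its integral over the
    levels is the excess [max (|x - y| - M, 0)]. *)
Definition hinge_kernel (M z : R) : R := (M < z)%R%:R.

Lemma hinge_kernel_ge0 M z : 0 <= hinge_kernel M z.
Proof. exact: ler0n. Qed.

Lemma hinge_kernel_nd (M : R) : {homo hinge_kernel M : x y / x <= y}.
Proof.
move=> x y xy; rewrite /hinge_kernel ler_nat.
by case: ltP => // Mx; rewrite (lt_le_trans Mx xy).
Qed.

Lemma int_kernel_hinge (M x y : R) : 0 <= M ->
  (\int[mu]_s (level_kernel (hinge_kernel M) s x y)%:E = 0)%E <-> `|x - y| <= M.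
Proof.
move=> M0; pose A : set R := `]y + M, x[%classic `|` `[x, y - M[%classic.
have -> : (\int[mu]_s (level_kernel (hinge_kernel M) s x y)%:E = mu A)%E.
  rewrite -[X in _ = mu X]setIT -integral_indic//; last exact: measurableU.
  apply: eq_integral => s _; rewrite /level_kernel /hinge_kernel indicE; congr EFin.
  rewrite in_setU !mem_setE !in_itv/=; case: ltP => sx /=;
    rewrite ?andbT ?andbF ?orbF /=; congr (nat_of_bool _)%:R;
    by apply/idP/idP => ?; lra.
have mA1 : measurable (`]y + M, x[%classic : set R) by [].
have mA2 : measurable (`[x, y - M[%classic : set R) by [].
split=> [A0|].
  have : (mu `](y + M)%R, x[ <= mu A)%E.
    by apply: le_measure; rewrite ?inE//; [exact: measurableU|move=> ?; left].
  have : (mu `[x, (y - M)%R[ <= mu A)%E.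
    by apply: le_measure; rewrite ?inE//; [exact: measurableU|move=> ?; right].
  rewrite A0 !lebesgue_measure_itv/= !lte_fin ler_norml.
  by do 2 case: ltP; rewrite -?EFinD ?lee_fin; move=> *; apply/andP; split; lra.
rewrite ler_norml => /andP[h1 h2].
rewrite /A set_itv_ge ?set_itv_ge ?setU0 ?measure0// bnd_simp; lra.
Qed.

End PowerKernel.

(** * The rearrangement as a generalized inverse of the distribution function *)

Section Rearrange.
Context {R : realType}.
Local Notation mu := (@lebesgue_measure R).

(** Preimages of the rays [[r, +oo[] are intervals. *)
Lemma nondecreasing_itv_measurable (i : interval R) (f : R -> R) :
  {in i &, {homo f : x y / x <= y}} -> measurable_fun [set` i] f.
Proof.
move=> f_nd.
have mi : measurable [set` i] by exact: measurable_itv.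
 apply: (measurability (@RGenCInfty.G R)) => [|/= _ [_] [r] -> <-].
  exact: RGenCInfty.measurableE.
apply: is_interval_measurable => s t/= [si fs] [ti ft] u /andP[su ut].
have ui : u \in i by apply: (@interval_is_interval _ i s t) => //; rewrite su ut.
by split => //; move: fs ft; rewrite /= !in_itv/= !andbT => fs _; rewrite (le_trans fs)// f_nd.
Qed.

Variables (a b : R) (g : R -> R).
Hypothesis ab : a < b.
Local Notation D := (`]a, b]%classic : set R).
Hypothesis mg : measurable_fun D g.

Let mD : measurable D. Proof. by []. Qed.

Let sublevel y := D `&` [set u | g u <= y].

Let msublevel y : measurable (sublevel y).
Proof.
have := mg mD (measurable_itv `]-oo, y]).
by congr measurable; apply/seteqP; split => u /=; rewrite in_itv.
Qed.

Let muD : mu D = (b - a)%:E.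
Proof. by rewrite lebesgue_measure_itv/= lte_fin ab EFinB. Qed.

Let mu_sublevel_le y : (mu (sublevel y) <= (b - a)%:E)%E.
Proof. by rewrite -muD le_measure ?inE//; [exact: msublevel|exact: subIsetl]. Qed.

Let mu_sublevel_fin y : mu (sublevel y) \is a fin_num.
Proof. by rewrite ge0_fin_numE// (le_lt_trans (mu_sublevel_le y))// ltry. Qed.

(** Substitute [u = a + (b - a) t]. The half-open [D] loses only a null set, and it avoids the
    endpoint [a], where the infimum in the rearrangement is a default value. *)
Lemma distr01_affine y : distr01 (fun t => g (a + (b - a) * t)) y =
  ((b - a)^-1%:E * mu (sublevel y))%E.
Proof.
have ba : 0 < b - a by rewrite subr_gt0.
rewrite (lebesgue_measure_affine a (lt0r_neq0 ba) (msublevel y)) gtr0_norm//.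
rewrite muleA -EFinM mulVf ?lt0r_neq0// mul1e /distr01.
have pre : affine a (b - a) @^-1` sublevel y =
    `]0, 1]%classic `&` [set t | g (a + (b - a) * t) <= y].
  apply/seteqP; split => t [] /=; rewrite /affine !in_itv/= => /andP[t1 t2] gy;
    by rewrite /sublevel; split=> //=; rewrite ?in_itv/=; apply/andP; split; nra.
have mpre : measurable (affine a (b - a) @^-1` sublevel y : set R).
  rewrite -[X in measurable X]setTI.
  exact: (@measurable_affine _ a (b - a) measurableT _ (msublevel y)).
have ind t : t \in (`]0, 1]%classic : set R) ->
    \1_[set v | g (a + (b - a) * v) <= y] t =
    \1_(affine a (b - a) @^-1` sublevel y) t :> R.
  move=> t01; rewrite !indicE; congr (nat_of_bool _)%:R.
  by rewrite pre in_setI t01.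
rewrite -integral_itv_obnd_cbnd; last first.
  apply/measurable_EFinP; apply: (eq_measurable_fun _ _ (measurable_indic mpre)).
  by move=> t /ind <-.
under eq_integral do rewrite ind//.
rewrite integral_indic//; congr (mu _).
by apply/setIidl; rewrite pre; exact: subIsetl.
Qed.

Local Notation gs := (rearrangement a b g).

Lemma rearrangementE u : gs u = inf [set y | ((u - a)%:E <= mu (sublevel y))%E].
Proof.
have ba : 0 < b - a by rewrite subr_gt0.
rewrite /rearrangement /rearrangement01; congr inf; apply/seteqP; split => y /=;
  by rewrite distr01_affine EFinM muleC lee_pmul2l// lte_fin invr_gt0.
Qed.

Variables lo hi : R.
Hypothesis glo : forall u, D u -> lo <= g u.
Hypothesis ghi : forall u, D u -> g u <= hi.

(** The point [c] of the overview, where the rearrangement crosses level [s]. *)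
Definition rearrangement_cut s : R := a + fine (mu (sublevel s)).
Local Notation c := rearrangement_cut.

Lemma rearrangement_cut_itv s : a <= c s <= b.
Proof.
rewrite /c lerDl fine_ge0//=; rewrite -lerBrDl -lee_fin fineK//.
Qed.

(** Galois connection between quantile and distribution function. The direction from left to right
    says that the infimum is attained, which is right continuity of the distribution function. *)
Lemma rearrangement_galois u s : D u -> (gs u <= s) = (u <= c s).
Proof.
rewrite /= in_itv/= => /andP[au ub].
have cE y : (u <= c y) = ((u - a)%:E <= mu (sublevel y))%E.
  by rewrite /c -lerBlDl -lee_fin fineK.
rewrite rearrangementE cE; set S := [set y | _].
(* As [u > a], an admissible [y] has a sublevel set of positive measure, hence nonempty, so
   [lo <= y]. With [Shi] this makes the infimum genuine. *)
have Slo : lbound S lo.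
  move=> y /= Sy; rewrite leNgt; apply/negP => ylo.
  have sub0 : sublevel y = set0.
    by rewrite -subset0 => v [/glo gv /= gy]; lra.
  by move: Sy; rewrite /S /= sub0 measure0 lee_fin; lra.
have Shi : S hi.
  rewrite /S /= (_ : sublevel hi = D) ?muD ?lee_fin; first lra.
  by apply/setIidl => v /ghi.
apply/idP/idP => [us|Ss]; last by apply: ge_inf => //; exists lo.
(* Right continuity comes from continuity of [mu] along the decreasing sets [F n]; each has measure
   at least [u - a], since some element of [S] lies below [s + 1/(n+1)]. *)
pose F n := sublevel (s + n.+1%:R^-1).
have Fcap : \bigcap_n F n = sublevel s.
  apply/seteqP; split => v.
    move=> Fv; split; first by have [] := Fv 0%N I.
    rewrite /= leNgt; apply/negP => sv.
    have [n sn] := ltr_add_invr sv.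
    by have [_ /=] := Fv n I; rewrite leNgt sn.
  by move=> [Dv gv] n _; split => //=; rewrite (le_trans gv)// lerDl.
have Fcvg : mu \o F @ \oo --> mu (sublevel s).
  rewrite -Fcap; apply: nonincreasing_cvg_mu.
  - by rewrite (le_lt_trans (mu_sublevel_le _))// ltry.
  - by move=> n; exact: msublevel.
  - rewrite Fcap. exact: msublevel.
  - move=> m n mn; apply/subsetPset => v [Dv gv]; split => //=.
    by rewrite (le_trans gv)// lerD2l lef_pV2 ?posrE// ler_nat.
rewrite -(cvg_lim _ Fcvg)//; apply: lime_ge; first by apply/cvg_ex; eexists; exact: Fcvg.
apply: nearW => n /=.
have [y Sy ysn] : exists2 y, S y & y < inf S + n.+1%:R^-1.
  by apply: inf_adherent => //; split; [exists hi|exists lo].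
apply: (le_trans Sy); apply: le_measure; rewrite ?inE;
  [exact: msublevel|exact: msublevel|move=> v [Dv gv]; split => //=].
by rewrite (le_trans gv)// (le_trans (ltW ysn))// lerD2r.
Qed.

Lemma rearrangement_nd : {in `]a, b] &, {homo gs : u v / u <= v}}.
Proof.
move=> u v Du Dv uv; rewrite rearrangement_galois//.
by rewrite (le_trans uv)// -rearrangement_galois.
Qed.

Lemma measurable_rearrangement : measurable_fun D gs.
Proof. by apply: nondecreasing_itv_measurable; exact: rearrangement_nd. Qed.

Lemma superlevel_rearrangement s : D `&` [set u | s < gs u] = `]c s, b]%classic.
Proof.
have /andP[ac cb] := rearrangement_cut_itv s.
apply/seteqP; split => u.
  move=> [Du /=]; rewrite ltNge rearrangement_galois// -ltNge => cu.
  by move: Du; rewrite /= !in_itv/= cu => /andP[].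
rewrite /= in_itv/= => /andP[cu ub]; have Du : D u by rewrite /= in_itv/=; apply/andP; split; lra.
by split => //=; rewrite ltNge rearrangement_galois// -ltNge.
Qed.

(** Both sides equal [b - c s]. *)
Lemma measure_superlevel_rearrangement s :
  mu (D `&` [set u | s < g u]) = mu (D `&` [set u | s < gs u]).
Proof.
have /andP[ac cb] := rearrangement_cut_itv s.
rewrite superlevel_rearrangement (_ : _ `&` _ = D `\` sublevel s); last first.
  apply/seteqP; split => u [Du] /= h; split => //.
    by move=> [_ /=]; rewrite leNgt h.
  by rewrite ltNge; apply/negP => gu; apply: h.
have Doo : (mu D < +oo)%E by rewrite muD ltry.
have -> : mu (D `\` sublevel s) = (mu D - mu (D `&` sublevel s))%E.
  exact: (@measureD _ _ _ mu _ _ mD (msublevel s) Doo).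
rewrite (_ : D `&` sublevel s = sublevel s); last by rewrite /sublevel setIA setIid.
rewrite muD lebesgue_measure_itv/= lte_fin -[mu (sublevel s)]fineK//.
move: ac cb; rewrite /c; set t := fine _ => ac cb.
by case: ltP => h; rewrite -?EFinB -?EFinD; congr EFin; lra.
Qed.

End Rearrange.

(** * Null sets for Lebesgue measure *)

Section Negligible.
Context {R : realType}.
Local Notation mu := (@lebesgue_measure R).

(** Whenever [h1 u < h2 u], two rationals [q < r] fit strictly between the values, so the set is
    covered by countably many null sets, indexed here through [unpickle]. *)
Lemma negligible_lt_fun (D : set R) (h1 h2 : R -> R) :
  (forall q r : R, q < r -> mu.-negligible (D `&` [set u | h1 u <= q /\ r < h2 u])) ->
  mu.-negligible (D `&` [set u | h1 u < h2 u]).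
Proof.
move=> h12; pose F n := if @unpickle (rat * rat)%type n is Some (q, r) then
  if ratr q < ratr r :> R then D `&` [set u | h1 u <= ratr q /\ ratr r < h2 u]
  else set0 else set0.
have NF : mu.-negligible (\bigcup_n F n).
  apply: negligible_bigcup => n; rewrite /F; case: unpickle => [[q r]|];
    last exact: negligible_set0.
  by case: ifPn => [/h12//|_]; exact: negligible_set0.
apply: negligibleS NF => u [Du /= u12].
have [r] := rat_in_itvoo u12; rewrite in_itv/= => /andP[h1r rh2].
have [q] := rat_in_itvoo h1r; rewrite in_itv/= => /andP[h1q qr].
exists (pickle (q, r)); first exact: Logic.I.
rewrite /F pickleK qr; split; first exact: Du.
by split; [exact: ltW|exact: rh2].
Qed.

Lemma not_negligible_point (A N : set R) : measurable A -> (0 < mu A)%E ->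
  mu.-negligible N -> exists2 u, A u & ~ N u.
Proof.
move=> mA A0 N0; apply: contrapT => noN; move: A0.
rewrite measure_negligible ?ltxx//; apply: negligibleS N0 => u Au.
by apply: contrapT => Nu; apply: noN; exists u.
Qed.

Lemma negligible1 (x : R) : mu.-negligible [set x].
Proof. by apply/negligibleP; [exact: measurable_set1|exact: lebesgue_measure_set1]. Qed.

End Negligible.

(** * Rearrangement against an increasing function *)

Section Monotone.
Context {R : realType}.
Local Notation mu := (@lebesgue_measure R).
Variables (a b : R) (f g : R -> R) (lo hi : R).
Hypothesis ab : a < b.
Local Notation D := (`]a, b]%classic : set R).
Hypothesis f_incr : strictly_increasing_on `[a, b] f.
Hypothesis mg : measurable_fun D g.
Hypothesis glo : forall u, D u -> lo <= g u.
Hypothesis ghi : forall u, D u -> g u <= hi.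
Local Notation gs := (rearrangement a b g).
Local Notation c := (rearrangement_cut a b g).
Local Notation I psi h := (\int[mu]_(u in D) \int[mu]_s
  (level_kernel psi s (h u) (f u))%:E)%E.

Let mD : measurable D. Proof. by []. Qed.

Let Doo : (mu D < +oo)%E.
Proof. by rewrite lebesgue_measure_itv/= lte_fin ab -EFinB ltry. Qed.

Let f_nd : {in `[a, b] &, {homo f : x y / x <= y}}.
Proof.
move=> x y xab yab; rewrite le_eqVlt => /predU1P[->//|xy].
by apply/ltW/f_incr.
Qed.

Let DS u : D u -> u \in `[a, b].
Proof. by rewrite /= !in_itv/= => /andP[/ltW -> ->]. Qed.

Let cS s : c s \in `[a, b].
Proof. by rewrite in_itv/=; exact: rearrangement_cut_itv. Qed.

Lemma measurable_increasing : measurable_fun D f.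
Proof. by apply: nondecreasing_itv_measurable => x y /DS xab /DS; exact: f_nd. Qed.

Let mgs : measurable_fun D gs.
Proof. exact: (measurable_rearrangement ab mg glo ghi). Qed.

(** The exchange results ask for measurability on the whole line, so [f], [g] and [gs] are extended
    by 0 outside [D]. *)
Let m0 (h : R -> R) : measurable_fun D h -> measurable_fun [set: R] (h \_ D).
Proof. by move=> mh; exact: (measurable_restrictT h mD).1. Qed.

Let h0E (h : R -> R) u : D u -> (h \_ D) u = h u.
Proof. by move=> Du; rewrite patchE mem_set. Qed.

Let I0 psi h : I psi h = (\int[mu]_(u in D) \int[mu]_s
  (level_kernel psi s ((h \_ D) u) ((f \_ D) u))%:E)%E.
Proof. by apply: eq_integral => u /set_mem Du; rewrite !h0E. Qed.

Let superlevelE (h : R -> R) s :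
  D `&` [set u | s < (h \_ D) u] = D `&` [set u | s < h u].
Proof. by apply/seteqP; split => u [Du] /=; rewrite h0E. Qed.

Let level_eq s : mu (D `&` [set u | s < (g \_ D) u]) =
  mu (D `&` [set u | s < (gs \_ D) u]).
Proof. by rewrite !superlevelE; exact: (measure_superlevel_rearrangement ab mg glo ghi). Qed.

(** The threshold is [f (c s)]: points lost in the exchange lie left of the cut and points gained
    lie right of it, so monotonicity of [f] gives this bound and the next two. *)
Let Ekappa s u : D u -> s < (g \_ D) u -> (gs \_ D) u <= s -> (f \_ D) u <= f (c s).
Proof.
move=> Du; rewrite !h0E// (rearrangement_galois ab mg glo ghi)// => _ uc.
by apply: f_nd => //; exact: DS.
Qed.

Let Fkappa_lt s u : D u -> s < (gs \_ D) u -> (g \_ D) u <= s -> f (c s) < (f \_ D) u.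
Proof.
move=> Du; rewrite !h0E// ltNge (rearrangement_galois ab mg glo ghi)// -ltNge => cu _.
by apply: f_incr => //; [exact: cS|exact: DS].
Qed.

Let Fkappa s u : D u -> (g \_ D) u <= s -> s < (gs \_ D) u -> f (c s) <= (f \_ D) u.
Proof. by move=> *; exact/ltW/Fkappa_lt. Qed.

Lemma rearrangement_kernel_le psi : {homo psi : x y / x <= y} ->
  (forall x, 0 <= psi x) -> (I psi gs <= I psi g)%E.
Proof.
move=> psi_nd psi0; rewrite !I0.
apply: (@le_int2_kernel _ _ _ mu D mD Doo psi psi_nd psi0 _ _ _ (f \o c)
  (m0 measurable_increasing) (m0 mg) (m0 mgs) level_eq Ekappa Fkappa).
Qed.

Lemma measurable_int_level_kernel psi (h : R -> R) : {homo psi : x y / x <= y} ->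
  (forall x, 0 <= psi x) -> measurable_fun D h ->
  measurable_fun D (fun u => \int[mu]_s (level_kernel psi s (h u) (f u))%:E)%E.
Proof.
move=> psi_nd psi0 mh.
apply: eq_measurable_fun (measurable_int_kernel1 mD psi_nd psi0
  (m0 measurable_increasing) (m0 mh)).
by move=> u /set_mem Du; rewrite !h0E.
Qed.

Let msup (h : R -> R) s : measurable_fun D h ->
  measurable (D `&` [set u | s < h u]).
Proof.
move=> mh; have := mh mD _ (measurable_itv `]s, +oo[).
by congr measurable; apply/seteqP; split => u /=; rewrite !in_itv/= andbT.
Qed.

Let capE (h1 h2 : R -> R) q r : D `&` [set u | h1 u <= q /\ r < h2 u] =
  (D `&` [set u | r < h2 u]) `\` (D `&` [set u | q < h1 u]).
Proof.
apply/seteqP; split => u.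
  by move=> [Du [hq rh]]; split; [split|move=> [_ /=]; rewrite ltNge hq].
move=> [[Du /= rh] nq]; split => //; split => //; rewrite leNgt; apply/negP => qh.
exact: nq.
Qed.

(** Without a gap [g = gs] almost everywhere. Then [A] contains two distinct points where both
    agree, although [g] decreases between them and [gs] does not. *)
Lemma rearrangement_superlevel_gap (A : set R) : measurable A -> A `<=` `[a, b] ->
  (0 < mu A)%E -> strictly_decreasing_on A g ->
  exists q r : R, q < r /\ (0 < mu (D `&` [set u | (g u <= q)%R /\ (r < gs u)%R]))%E.
Proof.
move=> mA Aab A0 g_decr.
apply: contrapT => nogap.
have N1 : mu.-negligible (D `&` [set u | g u < gs u]).
  apply: negligible_lt_fun => q r qr; rewrite capE.
  apply/negligibleP; first by apply: measurableD; exact: msup.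
  apply/eqP; rewrite eq_le measure_ge0 andbT leNgt -capE; apply/negP => gap.
  by apply: nogap; exists q, r.
have N2 : mu.-negligible (D `&` [set u | gs u < g u]).
  apply: negligible_lt_fun => q r qr.
  suff : mu.-negligible (D `&` [set u | gs u <= q /\ q < g u]).
    apply: negligibleS; by move=> u [Du [/= ? ?]]; split => //; split => //; exact: lt_trans qr _.
  have mE := msup q mg; have mF := msup q mgs.
  rewrite capE; apply/negligibleP; first exact: measurableD.
  (* Up to a null set no point enters the superlevel set of [gs]; since it has the same finite
     measure as that of [g], no point leaves it either. *)
  have FE0 : mu ((D `&` [set u | q < gs u]) `\` (D `&` [set u | q < g u])) = 0%E.
    apply: measure_negligible; first exact: measurableD.
    apply: negligibleS N1 => u [[Du /= qg] nq]; split => //=.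
    by rewrite (le_lt_trans _ qg)// leNgt; apply/negP => ?; apply: nq.
  have EF : mu (D `&` [set u | q < g u]) = mu (D `&` [set u | q < gs u]).
    exact: (measure_superlevel_rearrangement ab mg glo ghi).
  have Eoo : (mu (D `&` [set u | (q < g u)%R]) < +oo)%E.
    by rewrite (le_lt_trans _ Doo)//; apply: le_measure; rewrite ?inE//; exact: subIsetl.
  have Foo : (mu (D `&` [set u | (q < gs u)%R]) < +oo)%E by rewrite -EF.
  have FEd := @measureD _ _ _ mu _ _ mF mE Foo.
  have EFd := @measureD _ _ _ mu _ _ mE mF Eoo.
  rewrite -FE0; apply: (eq_trans EFd); apply/esym; apply: (eq_trans FEd).
  by congr (_ - mu _)%E; [exact/esym|exact: setIC].
(* The point [a] is excluded because [A] may contain it while [D] does not; excluding [u] next makes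
   [v] a different point. *)
have N3 := negligibleU (negligibleU N1 N2) (negligible1 a).
have [u Au Nu] := not_negligible_point mA A0 N3.
have [v Av Nv] := not_negligible_point mA A0 (negligibleU N3 (negligible1 u)).
have gsE w : A w -> ~ (((D `&` [set u | g u < gs u]) `|`
    (D `&` [set u | gs u < g u])) `|` [set a]) w -> D w /\ g w = gs w.
  move=> Aw Nw; have Dw : D w.
    have := Aab _ Aw; rewrite /= !in_itv/= => /andP[aw ->]; rewrite andbT lt_neqAle aw andbT.
    by apply/eqP => aw'; apply: Nw; right.
  split=> //; case: (ltgtP (g w) (gs w)) => // h; exfalso; apply: Nw; left; [left|right]; by [].
have [Du gu] := gsE _ Au Nu.
have [Dv gv] := gsE _ Av (fun h => Nv (or_introl h)).
have gs_nd := rearrangement_nd ab mg glo ghi.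
have [uv|vu|uv] := ltgtP u v.
- have := g_decr _ _ Au Av uv; rewrite gu gv ltNge => /negP; apply; exact: gs_nd (ltW uv).
- have := g_decr _ _ Av Au vu; rewrite gu gv ltNge => /negP; apply; exact: gs_nd (ltW vu).
- by apply: Nv; right.
Qed.

Lemma rearrangement_kernel_lt psi (A : set R) : {homo psi : x y / x <= y} ->
  (forall x, 0 <= psi x) -> (forall x y, 0 <= x -> x < y -> psi x < psi y) ->
  measurable A -> A `<=` `[a, b] -> (0 < mu A)%E -> strictly_decreasing_on A g ->
  (I psi g < +oo)%E -> (I psi gs < I psi g)%E.
Proof.
move=> psi_nd psi0 psi_lt mA Aab A0 g_decr; rewrite !I0 => Ioo.
have [q [r [qr gap]]] := rearrangement_superlevel_gap mA Aab A0 g_decr.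
(* For every level [s] in [[q, r]] the gap set lies in the superlevel set of [gs] but not in that of
   [g]. Monotonicity bounds [f] by its values at the endpoints. *)
apply: (@lt_int2_kernel _ _ _ mu D mD Doo psi psi_nd psi0 _ _ _ (f \o c)
  (m0 measurable_increasing) (m0 mg) (m0 mgs) level_eq Ekappa Fkappa
  (`|f a| + `|f b|) `[q, r]%classic) => //.
- move=> u Du; rewrite h0E//.
  have aab : a \in `[a, b] by rewrite in_itv/= lexx ltW.
  have bab : b \in `[a, b] by rewrite in_itv/= lexx ltW.
  have uab := DS Du; have := uab; rewrite in_itv/= => /andP[au ub].
  have := f_nd aab uab au; have := f_nd uab bab ub.
  have := ler_norm (f b); have := ler_norm (- f a); rewrite normrN.
  have := normr_ge0 (f a); have := normr_ge0 (f b).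
  by move=> *; rewrite ler_norml; apply/andP; split; lra.
- by rewrite lebesgue_measure_itv/= lte_fin qr -EFinB lte_fin subr_gt0.
- move=> s; rewrite /= in_itv/= => /andP[qs sr].
  rewrite !superlevelE (lt_le_trans gap)//.
  apply: le_measure; rewrite ?inE.
  + by rewrite capE; apply: measurableD; exact: msup.
  + by apply: measurableD; exact: msup.
  + move=> u [Du [gq rg]]; split; first by split => //=; exact: le_lt_trans rg.
    by move=> [_ /=]; rewrite ltNge (le_trans gq).
Qed.

End Monotone.

(** * From kernel integrals to the norms *)

Section LpDist.
Context {R : realType}.
Local Notation mu := (@lebesgue_measure R).
Variables (a b : R) (f g : R -> R) (c : R).
Hypothesis ab : a < b.
Local Notation U := (`[a, b]%classic : set R).
Local Notation D := (`]a, b]%classic : set R).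
Hypothesis f_incr : strictly_increasing_on U f.
Hypothesis mgU : measurable_fun U g.
Hypothesis c0 : 0 < c.
Hypothesis fg : forall u, U u -> `|f u - g u| <= c.
Local Notation gs := (rearrangement a b g).
Local Notation I psi h := (\int[mu]_(u in D) \int[mu]_s
  (level_kernel psi s (h u) (f u))%:E)%E.

Let mD : measurable D. Proof. by []. Qed.

Let muD : mu D = (b - a)%:E.
Proof. by rewrite lebesgue_measure_itv/= lte_fin ab EFinB. Qed.

Let DU u : D u -> U u.
Proof. by rewrite /= !in_itv/= => /andP[/ltW -> ->]. Qed.

Let mg : measurable_fun D g.
Proof. by apply: measurable_funS mgU => // u; exact: DU. Qed.

Let mf : measurable_fun D f.
Proof. exact: measurable_increasing. Qed.

Let aU : U a. Proof. by rewrite /= in_itv/= lexx ltW. Qed.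
Let bU : U b. Proof. by rewrite /= in_itv/= lexx ltW. Qed.

Let f_nd u v : U u -> U v -> u <= v -> f u <= f v.
Proof.
by move=> Uu Uv; rewrite le_eqVlt => /predU1P[->//|uv]; exact/ltW/f_incr.
Qed.

Let glo u : D u -> f a - c <= g u.
Proof.
move=> /DU Uu; have /andP[au ub] : a <= u <= b by move: Uu; rewrite /= in_itv.
have := fg Uu; have := f_nd aU Uu au; rewrite ler_norml => ? /andP[? ?]; lra.
Qed.

Let ghi u : D u -> g u <= f b + c.
Proof.
move=> /DU Uu; have /andP[au ub] : a <= u <= b by move: Uu; rewrite /= in_itv.
have := fg Uu; have := f_nd Uu bU ub; rewrite ler_norml => ? /andP[? ?]; lra.
Qed.

Let mgs : measurable_fun D gs.
Proof. exact: (measurable_rearrangement ab mg glo ghi). Qed.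

Let mnorm (h : R -> R) r : measurable_fun D h ->
  measurable_fun D (fun u => (`|h u - f u| `^ r)%:E).
Proof.
move=> mh; apply/measurable_EFinP.
apply: (measurableT_comp (measurable_powR r)).
by apply: measurableT_comp => //; exact: measurable_funB.
Qed.

Lemma Lp_dist_powR (h : R -> R) r : 0 < r -> measurable_fun D h ->
  Lp_dist U r%:E h f = ((\int[mu]_(u in D) (`|h u - f u| `^ r)%:E) `^ r^-1)%E.
Proof.
move=> r0 mh; rewrite /Lp_dist unlock; congr (_ `^ _)%E.
rewrite integral_itv_obnd_cbnd; last exact: mnorm.
rewrite [RHS]integral_mkcond; apply: eq_integral => u _.
rewrite /= !patchE; case: ifPn => _ //.
by rewrite normr0 powR0 ?gt_eqF.
Qed.

Lemma int_kernel_dist (h : R -> R) r : 1 <= r ->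
  I (powR_kernel r) h = (\int[mu]_(u in D) (`|h u - f u| `^ r)%:E)%E.
Proof. by move=> r1; apply: eq_integral => u _; rewrite int_kernel_powR. Qed.

Lemma int_dist_le r : 1 <= r ->
  (\int[mu]_(u in D) (`|g u - f u| `^ r)%:E <= (c `^ r * (b - a))%:E)%E.
Proof.
move=> r1; rewrite EFinM -muD -integral_cst//; apply: ge0_le_integral => //.
- exact: mnorm.
- move=> u /DU /fg; rewrite distrC => h; rewrite lee_fin; apply: ge0_ler_powR => //.
  + by lra.
  + by rewrite nnegrE ltW.
Qed.

Lemma Lp_distyE (h : R -> R) :
  Lp_dist U +oo%E h f = ess_sup mu (abse \o (EFin \o ((h \- f)%R \_ U))).
Proof.
(* The norm for infinite exponent tests whether the whole space has positive measure; [D] alone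
   suffices. *)
rewrite /Lp_dist unlock ifT//; apply: (@lt_le_trans _ _ (mu D)).
  by rewrite muD lte_fin subr_gt0.
by apply: le_measure; rewrite ?inE.
Qed.

(** A nonnegative integral vanishes exactly when its integrand does almost everywhere, which for the
    hinge kernel means [|h - f| <= M] almost everywhere. *)
Lemma Lp_disty_le (h : R -> R) M : 0 <= M -> measurable_fun D h ->
  (Lp_dist U +oo%E h f <= M%:E)%E <-> I (hinge_kernel M) h = 0%E.
Proof.
move=> M0 mh; rewrite Lp_distyE.
have nd := @hinge_kernel_nd R M; have ge0 := @hinge_kernel_ge0 R M.
have mI := measurable_int_level_kernel f_incr nd ge0 mh.
have -> : I (hinge_kernel M) h = (\int[mu]_(u in D)
    `|\int[mu]_s (level_kernel (hinge_kernel M) s (h u) (f u))%:E|)%E.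
  apply: eq_integral => u _; rewrite gee0_abs// integral_ge0// => s _.
  by rewrite lee_fin level_kernel_ge0.
split.
  move=> /ess_supP le_M; apply/ae_eq_integral_abs => //.
  apply: filterS le_M => u /= le_M Du; apply/int_kernel_hinge => //.
  by move: le_M; rewrite patchE mem_set//; exact: DU.
move=> /(ae_eq_integral_abs mu mD mI) h0; apply/ess_supP.
have na : {ae mu, forall u, u <> a}.
  by apply: negligibleS (negligible1 a) => u /=; rewrite not_notE.
apply: filterS2 h0 na => u h0 ua /=; rewrite patchE lee_fin.
case: ifPn => [/set_mem Uu|_]; last by rewrite normr0.
apply/int_kernel_hinge => //; apply: h0.
move: Uu; rewrite /= !in_itv/= => /andP[au ->]; rewrite andbT lt_neqAle au andbT.
by apply/eqP => /esym.
Qed.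

(** For finite [p] the kernel integrals are finite, and comparisons between them pass through the
    power [1/p], strictly increasing on nonnegative reals. *)
Lemma rearrangement_Lp (p : \bar R) : (1 <= p)%E ->
  [/\ (Lp_dist U p gs f <= Lp_dist U p g f)%E,
      (Lp_dist U p g f <= ((b - a) `^ fine p^-1%E * c)%:E)%E &
      forall A : set R, (1 < p < +oo)%E ->
        measurable A -> A `<=` U -> (0 < mu A)%E ->
        strictly_decreasing_on A g ->
        (Lp_dist U p gs f < Lp_dist U p g f)%E].
Proof.
case: p => [r|_|//]; last first.
  have gc : (Lp_dist U +oo%E g f <= c%:E)%E.
    rewrite Lp_distyE; apply/ess_supP; apply: aeW => u /=.
    rewrite patchE lee_fin; case: ifPn => [/set_mem/fg|_]; first by rewrite distrC.
    by rewrite normr0 ltW.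
  split; last by move=> A; rewrite ltxx andbF.
    have g0 : (0 <= Lp_dist U +oo%E g f)%E by exact: Lnorm_ge0.
    have gfin : Lp_dist U +oo%E g f \is a fin_num.
      by rewrite ge0_fin_numE// (le_lt_trans gc)// ltry.
    (* Take [M] equal to the norm of [g - f]. The hinge integral of [g] is then 0, and that of [gs]
       lies between 0 and it. *)
    rewrite -(fineK gfin); apply/Lp_disty_le => //; first exact: fine_ge0.
    apply/eqP; rewrite eq_le integral_ge0 ?andbT; last first.
      by move=> u _; apply: integral_ge0 => s _; rewrite lee_fin level_kernel_ge0.
    have <- : I (hinge_kernel (fine (Lp_dist U +oo%E g f))) g = 0%E.
      by apply/Lp_disty_le => //; [exact: fine_ge0|rewrite fineK].
    exact: (rearrangement_kernel_le ab f_incr mg glo ghi (@hinge_kernel_nd _ _)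
      (@hinge_kernel_ge0 _ _)).
  (* The inverse of [+oo] is 0, so the factor is [b - a] to the power 0, which is 1. *)
  by rewrite invey powRr0 mul1r.
rewrite lee_fin => r1; have r0 : 0 < r by lra.
have nd := powR_kernel_nd r1; have ge0 x := powR_kernel_ge0 x r1.
rewrite !Lp_dist_powR// -!int_kernel_dist//.
have Ioo : (I (powR_kernel r) g < +oo)%E.
  by rewrite int_kernel_dist// (le_lt_trans (int_dist_le r1))// ltry.
have I0 h : (0 <= I (powR_kernel r) h)%E.
  by apply: integral_ge0 => u _; apply: integral_ge0 => s _; rewrite lee_fin level_kernel_ge0.
have Ile := rearrangement_kernel_le ab f_incr mg glo ghi nd ge0.
have r'0 : 0 <= r^-1 by rewrite invr_ge0 ltW.
have fin h : (I (powR_kernel r) h < +oo)%E -> exists2 x : R, 0 <= x & I (powR_kernel r) h = x%:E.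
  move=> hoo; exists (fine (I (powR_kernel r) h)); first exact: fine_ge0.
  by rewrite fineK// ge0_fin_numE.
have [x x0 xE] := fin _ Ioo.
have [y y0 yE] := fin _ (le_lt_trans Ile Ioo).
rewrite xE yE !poweR_EFin; split.
- by rewrite lee_fin ge0_ler_powR ?nnegrE// -lee_fin -xE -yE.
- rewrite inver gt_eqF// lee_fin /=.
  have : x <= c `^ r * (b - a) by rewrite -lee_fin -xE int_kernel_dist// int_dist_le.
  have ba : 0 <= b - a by rewrite subr_ge0 ltW.
  have -> : (b - a) `^ r^-1 * c = (c `^ r * (b - a)) `^ r^-1.
    rewrite powRM ?powR_ge0// -powRrM divff ?gt_eqF// powRr1 1?ltW//.
    by rewrite mulrC.
  by move=> xc; rewrite ge0_ler_powR ?nnegrE// mulr_ge0 ?powR_ge0.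
move=> A; rewrite lte_fin => /andP[{}r1 _] mA AU A0 g_decr.
rewrite lte_fin gt0_ltr_powR ?nnegrE ?invr_gt0// -lte_fin -xE -yE.
apply: (rearrangement_kernel_lt ab f_incr mg glo ghi nd ge0 _ mA AU A0 g_decr Ioo).
by move=> s t; exact: powR_kernel_lt.
Qed.

End LpDist.

(** * Measurability of the Cornish-Fisher approximation *)

Section NormalQuantile.
Context {R : realType}.

(** The identity as a random variable under the normal law: [normal_cdf] becomes its [cdf], whose
    monotonicity and limits at infinity are known. *)
Let idR : measurableTypeR R -> R := idfun.

#[local] HB.instance Definition _ :=
  @isMeasurableFun.Build _ _ _ _ idR (@measurable_id _ _ setT).

Let idN : {RV (normal_prob 0 1 : probability _ R) >-> R} := idR.

Lemma normal_cdfE x : normal_cdf x = fine (cdf idN x) :> R.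
Proof. by []. Qed.

Lemma normal_cdf_ge (u : R) : u < 1 -> exists x, u <= normal_cdf x.
Proof.
move=> u1.
have : fine (cdf idN x) @[x --> +oo] --> (1 : R) by exact/fine_cvg/cvg_cdfy1.
move=> /cvgr_gt /(_ u u1) ux.
have [x] := filter_ex ux; exists x; exact: ltW.
Qed.

Lemma normal_cdf_lt (u : R) : 0 < u -> exists x, normal_cdf x < u.
Proof.
move=> u0.
have : fine (cdf idN x) @[x --> -oo] --> (0 : R) by exact/fine_cvg/cvg_cdfNy0.
move=> /cvgr_lt /(_ u u0) ux.
by have [x] := filter_ex ux; exists x.
Qed.

Lemma normal_cdf_nd : {homo (@normal_cdf R) : x y / x <= y}.
Proof.
move=> x y xy; rewrite !normal_cdfE.
by rewrite fine_le ?fin_num_measure// cdf_nondecreasing.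
Qed.

(** The set defining the quantile shrinks as [u] grows. Infima compare because the set for [v < 1]
    is nonempty and the one for [u > 0] is bounded below. *)
Lemma normal_quantile_nd :
  {in `]0, 1[ &, {homo (@normal_quantile R) : u v / u <= v}}.
Proof.
move=> u v; rewrite !in_itv/= => /andP[u0 _] /andP[_ v1] uv.
apply: lb_le_inf; first by have [x vx] := normal_cdf_ge v1; exists x.
move=> x /= vx; apply: ge_inf; last exact: le_trans vx.
have [y yu] := normal_cdf_lt u0; exists y => z /= uz.
rewrite leNgt; apply/negP => zy.
by move: yu; rewrite ltNge (le_trans uz)// normal_cdf_nd// ltW.
Qed.

Lemma measurable_cornish_fisher_approx (m : nat -> R) J n :
  measurable_fun (`]0, 1[%classic : set R) (cornish_fisher_approx m J n).
Proof.
rewrite /cornish_fisher_approx.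
apply: measurable_sum => j; apply: measurable_funM => //.
apply: (measurableT_comp (f := horner (cornish_fisher m j))).
  by apply: continuous_measurable_fun; exact: continuous_horner.
by apply: nondecreasing_itv_measurable; exact: normal_quantile_nd.
Qed.

End NormalQuantile.

(** Both halves apply [rearrangement_Lp] on [[eps n, 1 - eps n]], with error bound [a n] in the
    first and [C] times [n] to the power [- J/2] in the second. *)
Theorem proposition2 (R : realType) :
  (forall (d : nat -> measure_display) (T : forall n, measurableType (d n))
      (P : forall n, probability (T n) R) (X : forall n, {RV (P n) >-> R})
      (eps a : nat -> R) (Qhat err : nat -> R -> R),
    let Q n := quantile (P n) (X n) in
    let U n : set R := `[eps n, 1 - eps n]%classic in
    let Qstar n := rearrangement (eps n) (1 - eps n) (Qhat n) in
    (forall n, strictly_increasing_on `]0, 1[ (Q n)) ->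
    (forall n, 0 < eps n < 2^-1) ->
    (forall n, 0 < a n) -> a @ \oo --> (0 : R) ->
    (forall n, measurable_fun (U n) (Qhat n)) ->
    (forall n u, U n u ->
       Q n u = Qhat n u + err n u /\ `|err n u| <= a n) ->
    forall n (p : \bar R), (1 <= p)%E ->
      [/\ (Lp_dist (U n) p (Qstar n) (Q n)
             <= Lp_dist (U n) p (Qhat n) (Q n))%E,
          (Lp_dist (U n) p (Qhat n) (Q n)
             <= ((1 - 2 * eps n) `^ fine p^-1%E * a n)%:E)%E &
          forall A : set R, (1 < p < +oo)%E ->
            measurable A -> A `<=` U n -> (0 < lebesgue_measure A)%E ->
            strictly_decreasing_on A (Qhat n) ->
            (Lp_dist (U n) p (Qstar n) (Q n)
               < Lp_dist (U n) p (Qhat n) (Q n))%E]) /\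
  (forall (d0 : measure_display) (T0 : measurableType d0)
      (P0 : probability T0 R) (Y : {RV P0 >-> R})
      (d : nat -> measure_display) (T : forall n, measurableType (d n))
      (P : forall n, probability (T n) R)
      (Ys : forall n, 'I_n -> {RV (P n) >-> R})
      (J : nat) (C : R) (eps : nat -> R),
    let Q n := quantile (P n) (standardized_mean (Ys n)) in
    let Qhat n := cornish_fisher_approx (standardized_moment P0 Y) J n in
    let U n : set R := `[eps n, 1 - eps n]%classic in
    let Qstar n := rearrangement (eps n) (1 - eps n) (Qhat n) in
    (0 < J)%N ->
    (Y : T0 -> R) \in Lfun P0 (J.+1)%:R%:E -> (0 < 'V_P0[Y])%E ->
    (forall n, (0 < n)%N -> random_sample Y (Ys n)) ->
    (forall n, (0 < n)%N -> strictly_increasing_on `]0, 1[ (Q n)) ->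
    0 < C ->
    (forall n, (0 < n)%N -> 0 < eps n < 2^-1) ->
    (forall n n', (0 < n <= n')%N -> eps n' <= eps n) ->
    eps @ \oo --> (0 : R) ->
    (forall n u, (0 < n)%N -> U n u ->
       `|Q n u - Qhat n u| <= C * n%:R `^ (- (J%:R / 2))) ->
    forall n (p : \bar R), (0 < n)%N -> (1 <= p)%E ->
      [/\ (Lp_dist (U n) p (Qstar n) (Q n)
             <= Lp_dist (U n) p (Qhat n) (Q n))%E,
          (Lp_dist (U n) p (Qhat n) (Q n)
             <= ((1 - 2 * eps n) `^ fine p^-1%E *
                 (C * n%:R `^ (- (J%:R / 2))))%:E)%E &
          forall A : set R, (1 < p < +oo)%E ->
            measurable A -> A `<=` U n -> (0 < lebesgue_measure A)%E ->
            strictly_decreasing_on A (Qhat n) ->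
            (Lp_dist (U n) p (Qstar n) (Q n)
               < Lp_dist (U n) p (Qhat n) (Q n))%E]).
Proof.
have Uoo (e : R) : 0 < e < 2^-1 -> [/\ e < 1 - e, 1 - 2 * e = (1 - e) - e &
    (`[e, 1 - e]%classic : set R) `<=` `]0, 1[%classic].
  move=> /andP[e0 e2]; split; [lra|lra|].
  by move=> u /=; rewrite !in_itv/= => /andP[? ?]; apply/andP; split; lra.
have incr (h : R -> R) e : 0 < e < 2^-1 -> strictly_increasing_on `]0, 1[ h ->
    strictly_increasing_on `[e, 1 - e] h.
  by move=> /Uoo[_ _ sub] hh u v /sub ? /sub ?; exact: hh.
split.
  move=> d T P X eps a Qhat err Q U Qstar Q_incr eps12 a0 _ mQhat Qerr n p p1.
  have [ee -> _] := Uoo _ (eps12 n).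
  apply: rearrangement_Lp => //.
  - exact: incr.
  - exact: mQhat.
  by move=> u Uu; have [-> e] := Qerr n u Uu; rewrite addrC addKr.
move=> d0 T0 P0 Y d T P Ys J C eps Q Qhat U Qstar _ _ _ _ Q_incr C0 eps12 _ _ QQhat.
move=> n p n0 p1; have [ee -> sub] := Uoo _ (eps12 _ n0).
apply: rearrangement_Lp => //.
- by apply: incr; [exact: eps12|exact: Q_incr].
- by apply: measurable_funS sub _ => //; exact: measurable_cornish_fisher_approx.
- by rewrite mulr_gt0// powR_gt0// ltr0n.
- by move=> u; exact: QQhat.
Qed.
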